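(* In the sense of analytic continuation (regularization), $$\int_{0}^{\infty}\operatorname{Re}\!\left(\zeta\!\left(\tfrac12+iv\right)\right)dv=-\pi;$$ that is, $$\lim_{r\to1,\ r\neq1}\ \lim_{\phi\to\pi^{-}}\int_{0}^{\infty}\operatorname{Re}\!\left(r^{iv}\,\zeta\!\left(\tfrac12+iv\right)\right)\frac{\cosh(\phi v)}{\cosh(\pi v)}\,dv=-\pi.$$
   Context: $\zeta$ is the Riemann zeta function; $r>0$ and $\phi$ are real. The undamped integral is not claimed to converge. It is assigned a value by continuation of the damped integrals, which converge for $|\phi|<\pi$. Where the value at $(r,\phi)=(1,\pi)$ depends on the order of limits, the convention is that $\phi\to\pi$ is taken first (at $r\ne1$), followed by $r\to1$ along the real axis. *)

(* Defs.v *)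
From Stdlib Require Import Reals Lra Lia.
From Coquelicot Require Import Coquelicot.
Open Scope R_scope.

Definition Cexp (z : C) : C := (exp (Re z) * cos (Im z), exp (Re z) * sin (Im z)).

(* The principal power x^s of a positive real x; junk for x <= 0. *)
Definition cpow (x : R) (s : C) : C := Cexp (s * RtoC (ln x))%C.

(* Sum of a complex series, meaningful when it converges. *)
Definition CSeries (a : nat -> C) : C :=
  (Series (fun n => Re (a n)), Series (fun n => Im (a n))).

(* m^(-s) - int_m^(m+1) x^(-s) dx with m = n + 1, the integral in closed form. *)
Definition zeta_term (s : C) (n : nat) : C :=
  (cpow (INR (S n)) (- s)
   - (cpow (INR (S (S n))) (1 - s) - cpow (INR (S n)) (1 - s)) / (1 - s))%C.

(* The Riemann zeta function on the half-plane 0 < Re s, s <> 1, through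
     zeta(s) = 1/(s-1) + sum_(m >= 1) (m^(-s) - int_m^(m+1) x^(-s) dx).
   Lemma [zeta_Dirichlet] identifies it with the Dirichlet series for 1 < Re s,
   and [zeta_holomorphic] shows it is holomorphic for 0 < Re s, s <> 1, so it is
   the analytic continuation there.  Values with Re s <= 0 are not meaningful. *)
Definition zeta (s : C) : C := (1 / (s - 1) + CSeries (zeta_term s))%C.

Definition damped_integrand (r phi v : R) : R :=
  Re (cpow r (Ci * RtoC v) * zeta (RtoC (1 / 2) + Ci * RtoC v))%C
  * (cosh (phi * v) / cosh (PI * v)).

Definition damped_integral (r phi : R) : R :=
  RInt_gen (damped_integrand r phi) (at_point 0) (Rbar_locally p_infty).

(* Derivative of a complex-valued function of a real variable. *)
Definition is_Rderive (f : R -> C) (x : R) (l : C) : Prop :=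
  is_derive (fun t => Re (f t)) x (Re l) /\ is_derive (fun t => Im (f t)) x (Im l).

Definition is_Cseries (a : nat -> C) (l : C) : Prop :=
  is_series (fun n => Re (a n)) (Re l) /\ is_series (fun n => Im (a n)) (Im l).

Lemma C_ext (z w : C) : Re z = Re w -> Im z = Im w -> z = w.
Proof. destruct z, w; simpl; intros; subst; reflexivity. Qed.

Lemma Re_le_Cmod (z : C) : Rabs (Re z) <= Cmod z.
Proof. eapply Rle_trans; [apply Rmax_l | apply (Rmax_Cmod z)]. Qed.

Lemma Im_le_Cmod (z : C) : Rabs (Im z) <= Cmod z.
Proof. eapply Rle_trans; [apply Rmax_r | apply (Rmax_Cmod z)]. Qed.

Lemma Cmod_le_Re_Im (z : C) : Cmod z <= Rabs (Re z) + Rabs (Im z).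
Proof.
  pose proof (Rabs_pos (Re z)); pose proof (Rabs_pos (Im z)).
  apply Rsqr_incr_0_var; [| lra].
  unfold Cmod, Rsqr. rewrite sqrt_sqrt by nra.
  assert (A : forall t, t ^ 2 = Rabs t * Rabs t).
  { intro t. rewrite <- Rabs_mult, Rabs_pos_eq; [ring | nra]. }
  fold (Re z) (Im z). rewrite (A (Re z)), (A (Im z)). nra.
Qed.

Lemma is_Rderive_ext_l f x l l' : is_Rderive f x l -> l = l' -> is_Rderive f x l'.
Proof. intros; subst; assumption. Qed.

Lemma is_Rderive_plus f g x a b :
  is_Rderive f x a -> is_Rderive g x b -> is_Rderive (fun t => f t + g t)%C x (a + b)%C.
Proof.
  intros [F1 F2] [G1 G2]; split; simpl.
  - apply (is_derive_plus (fun t => Re (f t)) (fun t => Re (g t))); assumption.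
  - apply (is_derive_plus (fun t => Im (f t)) (fun t => Im (g t))); assumption.
Qed.

Lemma is_Rderive_mult f g x a b :
  is_Rderive f x a -> is_Rderive g x b ->
  is_Rderive (fun t => f t * g t)%C x (a * g x + f x * b)%C.
Proof.
  intros [F1 F2] [G1 G2]; split; simpl.
  - apply (is_derive_ext (fun t => Re (f t) * Re (g t) - Im (f t) * Im (g t)));
      [reflexivity |].
    evar_last.
    { apply (is_derive_minus (fun t => Re (f t) * Re (g t)) (fun t => Im (f t) * Im (g t)));
      apply (is_derive_mult (K := R_AbsRing)); eauto using Rmult_comm. }
    unfold minus, plus, opp, mult, Re, Im; simpl; ring.
  - apply (is_derive_ext (fun t => Re (f t) * Im (g t) + Im (f t) * Re (g t)));
      [reflexivity |].
    evar_last.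
    { apply (is_derive_plus (fun t => Re (f t) * Im (g t)) (fun t => Im (f t) * Re (g t)));
      apply (is_derive_mult (K := R_AbsRing)); eauto using Rmult_comm. }
    unfold minus, plus, opp, mult, Re, Im; simpl; ring.
Qed.

Lemma is_Rderive_const c x : is_Rderive (fun _ => c) x 0%C.
Proof. split; simpl; apply @is_derive_const. Qed.

Lemma is_Rderive_RtoC f x l : is_derive f x l -> is_Rderive (fun t => RtoC (f t)) x (RtoC l).
Proof. split; simpl; [assumption | apply @is_derive_const]. Qed.

Lemma is_Rderive_scal c f x a :
  is_Rderive f x a -> is_Rderive (fun t => c * f t)%C x (c * a)%C.
Proof.
  intro H. eapply is_Rderive_ext_l.
  - apply is_Rderive_mult; [apply is_Rderive_const | exact H].
  - cbv beta; ring.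
Qed.

Lemma is_Rderive_Cexp f x l : is_derive f x l -> forall s,
  is_Rderive (fun t => Cexp (s * RtoC (f t)))%C x (s * RtoC l * Cexp (s * RtoC (f x)))%C.
Proof.
  intros H s; assert (D : Derive (fun t => f t) x = l) by (apply is_derive_unique; exact H).
  assert (E : ex_derive f x) by (exists l; exact H).
  assert (A : forall t, Cexp (s * RtoC (f t)) =
    (exp (fst s * f t) * cos (snd s * f t), exp (fst s * f t) * sin (snd s * f t))).
  { intro t; unfold Cexp.
    replace (Re (s * RtoC (f t))%C) with (fst s * f t) by (unfold Re; simpl; ring).
    replace (Im (s * RtoC (f t))%C) with (snd s * f t) by (unfold Im; simpl; ring).
    reflexivity. }
  split.
  - apply (is_derive_ext (fun t => exp (fst s * f t) * cos (snd s * f t))).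
    { intro t; rewrite A; reflexivity. }
    auto_derive; [auto | rewrite D, A; simpl; ring].
  - apply (is_derive_ext (fun t => exp (fst s * f t) * sin (snd s * f t))).
    { intro t; rewrite A; reflexivity. }
    auto_derive; [auto | rewrite D, A; simpl; ring].
Qed.

Lemma Cexp_plus z w : Cexp (z + w)%C = (Cexp z * Cexp w)%C.
Proof.
  unfold Cexp; apply C_ext; unfold Re, Im; simpl;
    rewrite exp_plus, ?cos_plus, ?sin_plus; ring.
Qed.

Lemma Cmod_Cexp z : Cmod (Cexp z) = exp (Re z).
Proof.
  unfold Cexp, Cmod; simpl.
  transitivity (sqrt (exp (Re z) * exp (Re z))).
  - f_equal. pose proof (sin2_cos2 (Im z)) as H; unfold Rsqr in H.
    transitivity (exp (Re z) * exp (Re z) * (sin (Im z) * sin (Im z) + cos (Im z) * cos (Im z)));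
      [ring | rewrite H; ring].
  - apply sqrt_square, Rlt_le, exp_pos.
Qed.

Lemma cpow_plus x s t : cpow x (s + t) = (cpow x s * cpow x t)%C.
Proof. unfold cpow; rewrite <- Cexp_plus; f_equal; ring. Qed.

Lemma cpow_RtoC x a : cpow x (RtoC a) = RtoC (Rpower x a).
Proof.
  unfold cpow, Cexp, Rpower; apply C_ext; simpl.
  - replace (a * 0 + 0 * ln x) with 0 by ring; rewrite cos_0, Rmult_1_r; f_equal; ring.
  - replace (a * 0 + 0 * ln x) with 0 by ring; rewrite sin_0; ring.
Qed.

Lemma cpow_m1 x : 0 < x -> cpow x (- (1)) = RtoC (/ x).
Proof.
  intro H. replace (- (1))%C with (RtoC (- 1)) by (apply C_ext; simpl; ring).
  rewrite cpow_RtoC. f_equal. change (-1) with (- (1)). rewrite Rpower_Ropp, Rpower_1 by exact H; reflexivity.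
Qed.

Lemma Cmod_cpow x s : Cmod (cpow x s) = Rpower x (Re s).
Proof. unfold cpow, Rpower; rewrite Cmod_Cexp; f_equal; unfold Re; simpl; ring. Qed.

Lemma is_Rderive_cpow s x :
  0 < x -> is_Rderive (fun t => cpow t s) x (s * cpow x (s - 1))%C.
Proof.
  intro H. eapply is_Rderive_ext_l.
  - apply (is_Rderive_Cexp ln x (/ x)). now apply is_derive_Reals, derivable_pt_lim_ln.
  - fold (cpow x s). unfold Cminus. rewrite cpow_plus, cpow_m1 by exact H. ring.
Qed.

Lemma real_MVI (f f' : R -> R) a b M : a <= b ->
  (forall t, a <= t <= b -> is_derive f t (f' t)) ->
  (forall t, a <= t <= b -> Rabs (f' t) <= M) -> Rabs (f b - f a) <= M * (b - a).
Proof.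
  intros Hab D B.
  destruct (MVT_gen f a b f') as [c [Hc E]].
  - intros t; rewrite Rmin_left, Rmax_right by exact Hab; intros; apply D; lra.
  - intros t; rewrite Rmin_left, Rmax_right by exact Hab; intros.
    apply derivable_continuous_pt. exists (f' t). apply is_derive_Reals, D; lra.
  - rewrite Rmin_left, Rmax_right in Hc by exact Hab.
    rewrite E, Rabs_mult, (Rabs_pos_eq (b - a)) by lra.
    apply Rmult_le_compat_r; [lra | apply B, Hc].
Qed.

Lemma complex_MVI (f f' : R -> C) a b M : a <= b ->
  (forall t, a <= t <= b -> is_Rderive f t (f' t)) ->
  (forall t, a <= t <= b -> Cmod (f' t) <= M) ->
  Cmod (f b - f a)%C <= 2 * M * (b - a).
Proof.
  intros Hab D B. eapply Rle_trans; [apply Cmod_le_Re_Im |].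
  assert (H1 : Rabs (Re (f b) - Re (f a)) <= M * (b - a)).
  { apply (real_MVI (fun t => Re (f t)) (fun t => Re (f' t))); [exact Hab | |].
    - intros t Ht; apply (D t Ht).
    - intros t Ht; eapply Rle_trans; [apply Re_le_Cmod | apply (B t Ht)]. }
  assert (H2 : Rabs (Im (f b) - Im (f a)) <= M * (b - a)).
  { apply (real_MVI (fun t => Im (f t)) (fun t => Im (f' t))); [exact Hab | |].
    - intros t Ht; apply (D t Ht).
    - intros t Ht; eapply Rle_trans; [apply Im_le_Cmod | apply (B t Ht)]. }
  change (Re (f b - f a)%C) with (Re (f b) - Re (f a)).
  change (Im (f b - f a)%C) with (Im (f b) - Im (f a)). lra.
Qed.

Lemma Cexp_0 : Cexp 0 = 1%C.
Proof. unfold Cexp; apply C_ext; simpl; rewrite exp_0, ?cos_0, ?sin_0; ring. Qed.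

Lemma exp_le_mono x y : x <= y -> exp x <= exp y.
Proof.
  intros [H | ->]; [left; apply exp_increasing; exact H | right; reflexivity].
Qed.

Lemma Cmod_Cexp_le z (t : R) : 0 <= t <= 1 -> Cmod (Cexp (z * RtoC t)) <= exp (Cmod z).
Proof.
  intro H. rewrite Cmod_Cexp. apply exp_le_mono. simpl.
  pose proof (Re_le_Cmod z). pose proof (Rle_abs (Re z)). pose proof (Cmod_ge_0 z).
  unfold Re in *. nra.
Qed.

Lemma Cexp_bound1 z (u : R) : 0 <= u <= 1 ->
  Cmod (Cexp (z * RtoC u) - 1)%C <= 2 * (Cmod z * exp (Cmod z)).
Proof.
  intro Hu.
  assert (P : 0 <= Cmod z * exp (Cmod z)).
  { apply Rmult_le_pos; [apply Cmod_ge_0 | left; apply exp_pos]. }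
  assert (Z : Cexp (z * RtoC 0) = 1%C).
  { rewrite <- Cexp_0. apply (f_equal Cexp). ring. }
  rewrite <- Z.
  eapply Rle_trans.
  - apply (complex_MVI (fun t => Cexp (z * RtoC t)) (fun t => z * RtoC 1 * Cexp (z * RtoC t))%C
             0 u (Cmod z * exp (Cmod z))); [lra | |].
    + intros t Ht. apply (is_Rderive_Cexp (fun t => t)). apply @is_derive_id.
    + intros t Ht. rewrite !Cmod_mult, Cmod_1, Rmult_1_r.
      apply Rmult_le_compat_l; [apply Cmod_ge_0 | apply Cmod_Cexp_le; lra].
  - nra.
Qed.

Lemma Cexp_bound2 z :
  Cmod (Cexp z - 1 - z)%C <= 4 * (Cmod z * Cmod z * exp (Cmod z)).
Proof.
  pose (f := fun t : R => (Cexp (z * RtoC t) + (- z) * RtoC t)%C).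
  replace (Cexp z - 1 - z)%C with (f 1 - f 0)%C.
  2:{ unfold f. replace (z * RtoC 0)%C with (RtoC 0) by ring.
      rewrite Cexp_0. rewrite !Cmult_1_r. ring. }
  eapply Rle_trans.
  - apply (complex_MVI f (fun t => z * (Cexp (z * RtoC t) - 1))%C
             0 1 (Cmod z * (2 * (Cmod z * exp (Cmod z))))); [lra | |].
    + intros t Ht. eapply is_Rderive_ext_l.
      * apply is_Rderive_plus.
        -- apply (is_Rderive_Cexp (fun t => t)). apply @is_derive_id.
        -- apply is_Rderive_scal, (is_Rderive_RtoC (fun t => t)), @is_derive_id.
      * change (@one R_AbsRing) with 1. simpl. ring.
    + intros t Ht. rewrite Cmod_mult.
      apply Rmult_le_compat_l; [apply Cmod_ge_0 | apply Cexp_bound1; lra].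
  - right; ring.
Qed.

(* Here w is the derivative of W, so W (x + 1) - W x is the integral of w over
   [x, x + 1]. *)
Lemma taylor_step (w W w' : R -> C) K e x : 1 <= x -> 0 < e -> 
  (forall t, 1 <= t -> is_Rderive W t (w t)) ->
  (forall t, 1 <= t -> is_Rderive w t (w' t)) ->
  (forall t, 1 <= t -> Cmod (w' t) <= K * Rpower t (- 1 - e)) ->
  Cmod (w x - (W (x + 1)%R - W x))%C <= 4 * K * Rpower x (- 1 - e).
Proof.
  intros Hx He DW Dw B.
  assert (K0 : 0 <= K * Rpower x (- 1 - e)).
  { eapply Rle_trans; [apply Cmod_ge_0 | apply B; exact Hx]. }
  assert (K1 : 0 <= K).
  { pose proof (exp_pos ((- 1 - e) * ln x)). unfold Rpower in K0. nra. }
  assert (B' : forall t, x <= t -> Cmod (w' t) <= K * Rpower x (- 1 - e)).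
  { intros t Ht. eapply Rle_trans; [apply B; lra |].
    apply Rmult_le_compat_l; [exact K1 |]. unfold Rpower. apply exp_le_mono.
    assert (ln x <= ln t) by (apply ln_le; lra). nra. }
  pose (f := fun t : R => (W t + (- w x) * RtoC t)%C).
  replace (w x - (W (x + 1)%R - W x))%C with (- (f (x + 1)%R - f x))%C.
  2:{ unfold f. rewrite RtoC_plus. ring. }
  rewrite Cmod_opp. eapply Rle_trans.
  - apply (complex_MVI f (fun t => w t - w x)%C x (x + 1) (2 * (K * Rpower x (- 1 - e))));
      [lra | |].
    + intros t Ht. eapply is_Rderive_ext_l.
      * apply is_Rderive_plus; [apply DW; lra |].
        apply is_Rderive_scal, (is_Rderive_RtoC (fun t => t)), @is_derive_id.
      * change (@one R_AbsRing) with 1. ring.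
    + intros t Ht. eapply Rle_trans.
      * apply (complex_MVI w w' x t (K * Rpower x (- 1 - e))); [lra | |];
          intros u Hu; [apply Dw; lra | apply B'; lra].
      * nra.
  - right; ring.
Qed.

Lemma is_lim_seq_Rpower e : 0 < e -> is_lim_seq (fun n => Rpower (INR (S n)) (- e)) 0.
Proof.
  intro He.
  apply (is_lim_comp_seq (fun x => Rpower x (- e)) (fun n => INR (S n)) p_infty 0).
  - unfold Rpower. apply (is_lim_comp exp (fun x => - e * ln x) p_infty 0 m_infty).
    + apply is_lim_exp_m.
    + evar_last; [apply is_lim_scal_l, is_lim_ln_p |].
      apply is_Rbar_mult_unique; unfold is_Rbar_mult; simpl.
      destruct (Rle_dec 0 (- e)); [exfalso; lra | reflexivity].
    + exists 0; intros; discriminate.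
  - exists O; intros; discriminate.
  - apply (is_lim_seq_incr_1 INR), is_lim_seq_INR.
Qed.

Lemma is_series_telescope (u : nat -> R) (l : R) :
  is_lim_seq u l -> is_series (fun n => u (S n) - u n) (l - u O).
Proof.
  intro H. change (is_lim_seq (sum_n (fun n => u (S n) - u n)) (l - u O)).
  apply (is_lim_seq_ext (fun n => u (S n) - u O)).
  - induction n as [| n IH]; [rewrite sum_O; reflexivity |].
    rewrite sum_Sn, <- IH. unfold plus; simpl. ring.
  - apply is_lim_seq_minus'; [apply (is_lim_seq_incr_1 u), H | apply is_lim_seq_const].
Qed.

Lemma ex_series_Rpower e : 0 < e -> ex_series (fun n => Rpower (INR (S n)) (- 1 - e)).
Proof.
  intro He.
  assert (T : forall x, 0 < x ->
    Rpower (x + 1) (- 1 - e) <= / e * (Rpower x (- e) - Rpower (x + 1) (- e))).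
  { intros x Hx.
    assert (D : forall t, 0 < t ->
      is_derive (fun t => Rpower t (- e)) t (- e * Rpower t (- 1 - e))).
    { intros t Ht. apply is_derive_Reals.
      replace (- 1 - e) with (- e - 1) by ring. apply derivable_pt_lim_power, Ht. }
    destruct (MVT_gen (fun t => Rpower t (- e)) x (x + 1)
                (fun t => - e * Rpower t (- 1 - e))) as [c [Hc E]].
    - intros t; rewrite Rmin_left, Rmax_right by lra; intros; apply D; lra.
    - intros t; rewrite Rmin_left, Rmax_right by lra; intros.
      apply derivable_continuous_pt. eexists. apply is_derive_Reals, D; lra.
    - rewrite Rmin_left, Rmax_right in Hc by lra.
      assert (C : Rpower (x + 1) (- 1 - e) <= Rpower c (- 1 - e)).
      { unfold Rpower. apply exp_le_mono.
        assert (ln c <= ln (x + 1)) by (apply ln_le; lra). nra. }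
      eapply Rle_trans; [exact C |]. right.
      transitivity (/ e * - (Rpower (x + 1) (- e) - Rpower x (- e))); [| ring].
      rewrite E. field. lra. }
  apply (ex_series_incr_1 (fun n => Rpower (INR (S n)) (- 1 - e))).
  apply (ex_series_le (K := R_AbsRing) (V := R_CompleteNormedModule) _
    (fun n => / e * (Rpower (INR (S n)) (- e) - Rpower (INR (S (S n))) (- e)))).
  - intro n. change (norm ?a) with (Rabs a).
    rewrite Rabs_pos_eq by (left; apply exp_pos).
    rewrite !(S_INR (S n)). apply T. apply lt_0_INR; lia.
  - apply (ex_series_scal (K := R_AbsRing) (V := R_NormedModule) (/ e)
      (fun n => Rpower (INR (S n)) (- e) - Rpower (INR (S (S n))) (- e))).
    eexists.
    apply (is_series_ext (fun n => - Rpower (INR (S (S n))) (- e) - - Rpower (INR (S n)) (- e))).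
    + intro n. match goal with |- ?a = ?b => change (@eq R a b) end. ring.
    + apply (is_series_telescope (fun n => - Rpower (INR (S n)) (- e)) (- 0)).
      exact (proj1 (is_lim_seq_opp _ _) (is_lim_seq_Rpower e He)).
Qed.

Lemma is_Cseries_plus a b l m :
  is_Cseries a l -> is_Cseries b m -> is_Cseries (fun n => a n + b n)%C (l + m)%C.
Proof.
  intros [A1 A2] [B1 B2]; split.
  - exact (is_series_plus _ _ _ _ A1 B1).
  - exact (is_series_plus _ _ _ _ A2 B2).
Qed.

Lemma is_Cseries_scal c a l :
  is_Cseries a l -> is_Cseries (fun n => c * a n)%C (c * l)%C.
Proof.
  intros [A1 A2]; split.
  - exact (is_series_minus _ _ _ _
      (is_series_scal (K := R_AbsRing) (V := R_NormedModule) (Re c) _ _ A1)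
      (is_series_scal (K := R_AbsRing) (V := R_NormedModule) (Im c) _ _ A2)).
  - exact (is_series_plus _ _ _ _
      (is_series_scal (K := R_AbsRing) (V := R_NormedModule) (Re c) _ _ A2)
      (is_series_scal (K := R_AbsRing) (V := R_NormedModule) (Im c) _ _ A1)).
Qed.

Lemma is_Cseries_ext a b l :
  (forall n, a n = b n) -> is_Cseries a l -> is_Cseries b l.
Proof.
  intros E [A1 A2]; split.
  - apply (is_series_ext (fun n => Re (a n))); [intro n; rewrite E; reflexivity | exact A1].
  - apply (is_series_ext (fun n => Im (a n))); [intro n; rewrite E; reflexivity | exact A2].
Qed.

Lemma is_Cseries_unique a l : is_Cseries a l -> CSeries a = l.
Proof.
  intros [A1 A2]; apply C_ext; unfold CSeries, Re at 1, Im at 1; simpl;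
    apply is_series_unique; assumption.
Qed.

Lemma real_series_bound a b :
  ex_series b -> (forall n, Rabs (a n) <= b n) -> ex_series a /\ Rabs (Series a) <= Series b.
Proof.
  intros Hb H.
  assert (A : ex_series (fun n => Rabs (a n))).
  { apply (ex_series_le (K := R_AbsRing) (V := R_CompleteNormedModule) _ b); [| exact Hb].
    intro n. change (norm ?u) with (Rabs u). rewrite Rabs_Rabsolu. apply H. }
  split; [apply ex_series_Rabs, A |].
  eapply Rle_trans; [apply Series_Rabs, A |].
  apply Series_le; [| exact Hb]. intro n; split; [apply Rabs_pos | apply H].
Qed.

Lemma is_Cseries_bound a K e : 0 < e ->
  (forall n, Cmod (a n) <= K * Rpower (INR (S n)) (- 1 - e)) ->
  is_Cseries a (CSeries a) /\
  Cmod (CSeries a) <= 2 * K * Series (fun n => Rpower (INR (S n)) (- 1 - e)).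
Proof.
  intros He H.
  assert (B : ex_series (fun n => K * Rpower (INR (S n)) (- 1 - e))).
  { apply (ex_series_scal (K := R_AbsRing) (V := R_NormedModule) K), ex_series_Rpower, He. }
  destruct (real_series_bound (fun n => Re (a n)) _ B) as [R1 R2].
  { intro n; eapply Rle_trans; [apply Re_le_Cmod | apply H]. }
  destruct (real_series_bound (fun n => Im (a n)) _ B) as [I1 I2].
  { intro n; eapply Rle_trans; [apply Im_le_Cmod | apply H]. }
  rewrite Series_scal_l in R2, I2. split.
  - split; apply Series_correct; assumption.
  - eapply Rle_trans; [apply Cmod_le_Re_Im |].
    change (Re (CSeries a)) with (Series (fun n => Re (a n))).
    change (Im (CSeries a)) with (Series (fun n => Im (a n))). lra.
Qed.

Lemma sum_minus_integral (w W w' : R -> C) K e : 0 < e ->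
  (forall t, 1 <= t -> is_Rderive W t (w t)) ->
  (forall t, 1 <= t -> is_Rderive w t (w' t)) ->
  (forall t, 1 <= t -> Cmod (w' t) <= K * Rpower t (- 1 - e)) ->
  let a := fun n => (w (INR (S n)) - (W (INR (S (S n))) - W (INR (S n))))%C in
  is_Cseries a (CSeries a) /\
  Cmod (CSeries a) <= 8 * K * Series (fun n => Rpower (INR (S n)) (- 1 - e)).
Proof.
  intros He DW Dw B a.
  replace (8 * K) with (2 * (4 * K)) by ring.
  apply is_Cseries_bound; [exact He |]. intro n. unfold a. rewrite (S_INR (S n)).
  apply (taylor_step w W w'); try assumption.
  rewrite S_INR. pose proof (pos_INR n). lra.
Qed.

Lemma ln_le_Rpower e x : 0 < e -> 1 <= x -> 0 <= ln x <= / e * Rpower x e.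
Proof.
  intros He Hx. split.
  - rewrite <- ln_1. apply ln_le; lra.
  - apply Rmult_le_reg_l with e; [exact He |].
    rewrite <- Rmult_assoc, Rinv_r, Rmult_1_l by lra. unfold Rpower.
    pose proof (exp_ineq1_le (e * ln x)). lra.
Qed.

Lemma Rpower_le_exponent x a b : 1 <= x -> a <= b -> Rpower x a <= Rpower x b.
Proof.
  intros Hx Hab. unfold Rpower. apply exp_le_mono.
  assert (0 <= ln x) by (rewrite <- ln_1; apply ln_le; lra). nra.
Qed.

(* The primitive x^(1-s) / (1-s) of x^(-s). *)
Definition cprim (x : R) (s : C) : C := (cpow x (1 - s) / (1 - s))%C.

Lemma Cminus_neq_0 (s t : C) : s <> t -> (t - s)%C <> 0%C.
Proof. intros H E. apply H. symmetry. replace t with (t - s + s)%C by ring. rewrite E. ring. Qed.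

Lemma is_Rderive_cprim (s : C) (x : R) : 0 < x -> s <> 1%C ->
  is_Rderive (fun t => cprim t s) x (cpow x (- s)).
Proof.
  intros Hx Hs. apply Cminus_neq_0 in Hs. unfold cprim, Cdiv.
  eapply is_Rderive_ext_l.
  - apply is_Rderive_mult; [apply is_Rderive_cpow, Hx | apply is_Rderive_const].
  - replace (1 - s - 1)%C with (- s)%C by ring. cbv beta. field. exact Hs.
Qed.

Lemma zeta_term_cprim s n : zeta_term s n =
  (cpow (INR (S n)) (- s) - (cprim (INR (S (S n))) s - cprim (INR (S n)) s))%C.
Proof. unfold zeta_term, cprim, Cdiv. ring. Qed.

Lemma is_Cseries_zeta_term (s : C) : 0 < Re s -> s <> 1%C ->
  is_Cseries (zeta_term s) (CSeries (zeta_term s)).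
Proof.
  intros Hr Hs.
  destruct (sum_minus_integral (fun t => cpow t (- s)) (fun t => cprim t s)
    (fun t => - s * cpow t (- s - 1))%C (Cmod s) (Re s) Hr) as [A _].
  - intros t Ht. apply is_Rderive_cprim; [lra | exact Hs].
  - intros t Ht. apply is_Rderive_cpow. lra.
  - intros t Ht. rewrite Cmod_mult, Cmod_opp, Cmod_cpow. right. f_equal. f_equal.
    unfold Re; simpl; ring.
  - replace (CSeries (zeta_term s)) with
      (CSeries (fun n => cpow (INR (S n)) (- s) - (cprim (INR (S (S n))) s - cprim (INR (S n)) s))%C).
    + eapply is_Cseries_ext; [| exact A]. intro n; symmetry; apply zeta_term_cprim.
    + symmetry. apply is_Cseries_unique. eapply is_Cseries_ext; [| exact A].
      intro n; symmetry; apply zeta_term_cprim.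
Qed.

Lemma is_Cseries_is_series a l :
  is_Cseries a l -> is_series (K := C_AbsRing) (V := C_NormedModule) a l.
Proof.
  intros [A1 A2].
  assert (E : forall n, sum_n (G := C_NormedModule) a n =
    (sum_n (fun n => Re (a n)) n, sum_n (fun n => Im (a n)) n)).
  { induction n as [| n IH].
    - rewrite !sum_O. apply surjective_pairing.
    - rewrite !sum_Sn, IH. apply C_ext; reflexivity. }
  apply (filterlim_locally (U := C_UniformSpace)). intro eps.
  pose proof (proj1 (filterlim_locally _ _) A1 eps) as B1.
  pose proof (proj1 (filterlim_locally _ _) A2 eps) as B2.
  generalize (filter_and _ _ B1 B2). apply filter_imp. intros n [H1 H2].
  rewrite E. split; [exact H1 | exact H2].
Qed.

Theorem zeta_Dirichlet (s : C) : 1 < Re s ->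
  is_series (K := C_AbsRing) (V := C_NormedModule)
    (fun n => cpow (INR (S n)) (- s)) (zeta s).
Proof.
  intro Hr.
  assert (Hs : s <> 1%C) by (intros ->; simpl in Hr; lra).
  assert (Hs' := Cminus_neq_0 s 1 Hs).
  apply is_Cseries_is_series.
  assert (T : forall n, Cmod (cprim (INR (S n)) s) <=
                / Cmod (1 - s) * Rpower (INR (S n)) (- (Re s - 1))).
  { intro n. unfold cprim. rewrite Cmod_div, Cmod_cpow by exact Hs'.
    right. unfold Rdiv. rewrite Rmult_comm. f_equal. f_equal. unfold Re; simpl; ring. }
  assert (Z : is_lim_seq (fun n => / Cmod (1 - s) * Rpower (INR (S n)) (- (Re s - 1))) 0).
  { replace (Finite 0) with (Rbar_mult (/ Cmod (1 - s)) 0) by (simpl; f_equal; ring).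
    apply is_lim_seq_scal_l, is_lim_seq_Rpower. lra. }
  assert (S0 : forall p : C -> R, (forall z, Rabs (p z) <= Cmod z) ->
    is_lim_seq (fun n => p (cprim (INR (S n)) s)) 0).
  { intros p Hp. apply is_lim_seq_abs_0.
    apply (is_lim_seq_le_le (fun _ => 0) _
             (fun n => / Cmod (1 - s) * Rpower (INR (S n)) (- (Re s - 1)))).
    - intro n; split; [apply Rabs_pos | eapply Rle_trans; [apply Hp | apply T]].
    - apply is_lim_seq_const.
    - exact Z. }
  assert (Q : is_Cseries (fun n => cprim (INR (S (S n))) s - cprim (INR (S n)) s)%C
                         (0 - cprim (INR 1) s)%C).
  { split.
    - apply (is_series_telescope (fun n => Re (cprim (INR (S n)) s)) 0), S0, Re_le_Cmod.
    - apply (is_series_telescope (fun n => Im (cprim (INR (S n)) s)) 0), S0, Im_le_Cmod. }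
  assert (A : is_Cseries (zeta_term s) (CSeries (zeta_term s))).
  { apply is_Cseries_zeta_term; [lra | exact Hs]. }
  replace (zeta s) with (CSeries (zeta_term s) + (0 - cprim (INR 1) s))%C.
  - eapply is_Cseries_ext; [| apply (is_Cseries_plus _ _ _ _ A Q)].
    intro n; cbv beta. rewrite zeta_term_cprim. ring.
  - unfold zeta, cprim. change (INR 1) with 1. unfold cpow. rewrite ln_1.
    replace ((1 - s) * 0)%C with (RtoC 0) by ring. rewrite Cexp_0. field.
    split; [| exact Hs']. intro E. apply Hs. replace s with (s - 1 + 1)%C by ring.
    rewrite E. ring.
Qed.

Lemma is_Cderive_quadratic (f : C -> C) (s l : C) d K : 0 < d ->
  (forall h, Cmod h <= d -> Cmod (f (s + h) - f s - h * l)%C <= K * (Cmod h * Cmod h)) ->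
  is_derive (K := C_AbsRing) (V := C_NormedModule) f s l.
Proof.
  intros Hd H. split; [apply (is_linear_scal_l (K := C_AbsRing) (V := C_NormedModule)) |].
  intros x Hx.
  assert (Ex : x = s).
  { symmetry. apply (is_filter_lim_locally_unique (K := C_AbsRing)
      (V := AbsRing_NormedModule C_AbsRing)), Hx. }
  subst x. intro eps.
  assert (P : 0 < Rmin d (eps / (Rabs K + 1))).
  { apply Rmin_pos; [exact Hd |]. apply Rdiv_lt_0_compat; [apply cond_pos |].
    pose proof (Rabs_pos K); lra. }
  exists (mkposreal _ P). intros y Hy. change C in (type of y).
  change (Cmod (y - s)%C < Rmin d (eps / (Rabs K + 1))) in Hy.
  change (Cmod (f y - f s - (y - s) * l)%C <= eps * Cmod (y - s)%C).
  assert (D1 := Rmin_l d (eps / (Rabs K + 1))). assert (D2 := Rmin_r d (eps / (Rabs K + 1))).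
  specialize (H (y - s)%C). replace (s + (y - s))%C with y in H by ring.
  eapply Rle_trans; [apply H; lra |]. rewrite <- Rmult_assoc.
  apply Rmult_le_compat_r; [apply Cmod_ge_0 |].
  pose proof (Cmod_ge_0 (y - s)%C). pose proof (Rle_abs K). pose proof (Rabs_pos K).
  apply Rle_trans with ((Rabs K + 1) * (eps / (Rabs K + 1))).
  - nra.
  - right. field. lra.
Qed.

(* Derivatives in s of x^(-s) and of [cprim x s]. *)
Definition dcpow (x : R) (s : C) : C := (- RtoC (ln x) * cpow x (- s))%C.
Definition dcprim (x : R) (s : C) : C :=
  (- RtoC (ln x) * cprim x s + / (1 - s) * cprim x s)%C.

Lemma is_Rderive_ln x : 0 < x -> is_Rderive (fun t => - RtoC (ln t))%C x (- RtoC (/ x))%C.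
Proof.
  intro H. eapply is_Rderive_ext_l.
  - assert (E : is_Rderive (fun t => RtoC (ln t)) x (RtoC (/ x))).
    { apply is_Rderive_RtoC, is_derive_Reals, derivable_pt_lim_ln, H. }
    apply (is_Rderive_scal (- (1))%C) in E.
    destruct E as [E1 E2]; split.
    + apply (is_derive_ext (fun t => Re (- (1) * RtoC (ln t))%C)); [| exact E1].
      intro t; simpl; ring.
    + apply (is_derive_ext (fun t => Im (- (1) * RtoC (ln t))%C)); [| exact E2].
      intro t; simpl; ring.
  - ring.
Qed.

Lemma is_Rderive_dcprim (s : C) (x : R) : 0 < x -> s <> 1%C ->
  is_Rderive (fun t => dcprim t s) x (dcpow x s).
Proof.
  intros Hx Hs. assert (Hs' := Cminus_neq_0 s 1 Hs). unfold dcprim.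
  eapply is_Rderive_ext_l.
  - apply is_Rderive_plus.
    + apply is_Rderive_mult; [apply is_Rderive_ln, Hx | apply is_Rderive_cprim; assumption].
    + apply is_Rderive_scal, is_Rderive_cprim; assumption.
  - cbv beta. unfold dcpow, cprim.
    replace (1 - s)%C with (- s + 1)%C by ring.
    rewrite cpow_plus, <- cpow_m1 by exact Hx.
    assert (E : (cpow x (- (1)) * cpow x 1 = 1)%C).
    { rewrite <- cpow_plus. replace (- (1) + 1)%C with (RtoC 0) by ring.
      unfold cpow. rewrite Cmult_0_l. apply Cexp_0. }
    replace (- s + 1)%C with (1 - s)%C by ring.
    transitivity (- (cpow x (- (1)) * cpow x 1) * cpow x (- s) / (1 - s)
                  + - RtoC (ln x) * cpow x (- s) + / (1 - s) * cpow x (- s))%C.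
    + field. exact Hs'.
    + rewrite E. field. exact Hs'.
Qed.

Lemma is_Rderive_dcpow (s : C) (x : R) : 0 < x ->
  is_Rderive (fun t => dcpow t s) x (cpow x (- s - 1) * (s * RtoC (ln x) - 1))%C.
Proof.
  intro Hx. unfold dcpow. eapply is_Rderive_ext_l.
  - apply is_Rderive_mult; [apply is_Rderive_ln, Hx | apply is_Rderive_cpow, Hx].
  - cbv beta. unfold Cminus. rewrite cpow_plus, cpow_m1 by exact Hx. ring.
Qed.

Definition dzeta_term (s : C) (n : nat) : C :=
  (dcpow (INR (S n)) s - (dcprim (INR (S (S n))) s - dcprim (INR (S n)) s))%C.

Lemma is_Cseries_dzeta_term (s : C) : 0 < Re s -> s <> 1%C ->
  is_Cseries (dzeta_term s) (CSeries (dzeta_term s)).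
Proof.
  intros Hr Hs.
  apply (sum_minus_integral (fun t => dcpow t s) (fun t => dcprim t s)
    (fun t => cpow t (- s - 1) * (s * RtoC (ln t) - 1))%C
    (Cmod s * (/ (Re s / 2)) + 1) (Re s / 2)).
  - lra.
  - intros t Ht. apply is_Rderive_dcprim; [lra | exact Hs].
  - intros t Ht. apply is_Rderive_dcpow. lra.
  - intros t Ht. rewrite Cmod_mult, Cmod_cpow.
    replace (Re (- s - 1)%C) with (- 1 - Re s / 2 + - (Re s / 2)) by (unfold Re; simpl; field).
    rewrite Rpower_plus, Rmult_assoc, (Rmult_comm (_ + 1)).
    apply Rmult_le_compat_l; [left; apply exp_pos |].
    destruct (ln_le_Rpower (Re s / 2) t) as [L0 L1]; [lra | exact Ht |].
    assert (L2 : 1 <= Rpower t (Re s / 2)).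
    { rewrite <- (Rpower_O t) by lra. apply Rpower_le_exponent; lra. }
    assert (E : Rpower t (- (Re s / 2)) * Rpower t (Re s / 2) = 1).
    { rewrite <- Rpower_plus, Rplus_opp_l. apply Rpower_O. lra. }
    assert (B : Cmod (s * RtoC (ln t) - 1)%C <=
                (Cmod s * / (Re s / 2) + 1) * Rpower t (Re s / 2)).
    { eapply Rle_trans; [apply Cmod_triangle |].
      rewrite Cmod_mult, Cmod_opp, Cmod_1, Cmod_R, Rabs_pos_eq by exact L0.
      assert (Cmod s * ln t <= Cmod s * (/ (Re s / 2) * Rpower t (Re s / 2))).
      { apply Rmult_le_compat_l; [apply Cmod_ge_0 | exact L1]. }
      lra. }
    eapply Rle_trans; [apply Rmult_le_compat_l; [left; apply exp_pos | exact B] |].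
    right. transitivity ((Cmod s * / (Re s / 2) + 1) *
      (Rpower t (- (Re s / 2)) * Rpower t (Re s / 2))); [ring | rewrite E; ring].
Qed.

Lemma zeta_series_quadratic (s : C) : 0 < Re s -> s <> 1%C -> exists K, forall h : C,
  Cmod h <= Re s / 4 -> (s + h)%C <> 1%C ->
  Cmod (CSeries (zeta_term (s + h)) - CSeries (zeta_term s) - h * CSeries (dzeta_term s))%C
    <= K * (Cmod h * Cmod h).
Proof.
  intros Hr Hs. pose (A := / (Re s / 8)). pose (K := 4 * Cmod s * (A * A) + 2 * A).
  assert (A0 : 0 < A) by (apply Rinv_0_lt_compat; lra).
  exists (8 * K * Series (fun n => Rpower (INR (S n)) (- 1 - Re s / 2))).
  intros h Hh Hsh.
  assert (Hr' : 0 < Re (s + h)%C).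
  { change (Re (s + h)%C) with (Re s + Re h). pose proof (Re_le_Cmod h).
    apply Rabs_le_between in H. lra. }
  pose (a := fun n => (zeta_term (s + h) n - zeta_term s n - h * dzeta_term s n)%C).
  assert (Sa : is_Cseries a
    (CSeries (zeta_term (s + h)) - CSeries (zeta_term s) - h * CSeries (dzeta_term s))%C).
  { pose proof (is_Cseries_zeta_term _ Hr' Hsh) as S1.
    pose proof (is_Cseries_scal (- (1))%C _ _ (is_Cseries_zeta_term _ Hr Hs)) as S2.
    pose proof (is_Cseries_scal (- h)%C _ _ (is_Cseries_dzeta_term _ Hr Hs)) as S3.
    pose proof (is_Cseries_plus _ _ _ _ (is_Cseries_plus _ _ _ _ S1 S2) S3) as S4.
    replace (CSeries (zeta_term (s + h)) - CSeries (zeta_term s) - h * CSeries (dzeta_term s))%C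
      with (CSeries (zeta_term (s + h)) + - (1) * CSeries (zeta_term s)
            + - h * CSeries (dzeta_term s))%C by ring.
    eapply is_Cseries_ext; [| exact S4]. intro n. unfold a. ring. }
  rewrite <- (is_Cseries_unique _ _ Sa).
  pose (w := fun t => (cpow t (- (s + h)) + - (1) * cpow t (- s) + - h * dcpow t s)%C).
  pose (W := fun t => (cprim t (s + h) + - (1) * cprim t s + - h * dcprim t s)%C).
  pose (E := fun t => cpow t (- h)).
  pose (w' := fun t => (cpow t (- s - 1) *
    (- s * (E t - 1 - (- h) * RtoC (ln t)) + - h * (E t - 1)))%C).
  destruct (sum_minus_integral w W w' (K * (Cmod h * Cmod h)) (Re s / 2)) as [B1 B2].
  - lra.
  - intros t Ht. apply is_Rderive_plus; [apply is_Rderive_plus |].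
    + apply is_Rderive_cprim; [lra | exact Hsh].
    + apply is_Rderive_scal, is_Rderive_cprim; [lra | exact Hs].
    + apply is_Rderive_scal, is_Rderive_dcprim; [lra | exact Hs].
  - intros t Ht. eapply is_Rderive_ext_l.
    + apply is_Rderive_plus; [apply is_Rderive_plus |].
      * apply is_Rderive_cpow; lra.
      * apply is_Rderive_scal, is_Rderive_cpow; lra.
      * apply is_Rderive_scal, is_Rderive_dcpow; lra.
    + unfold w', E. replace (- (s + h) - 1)%C with ((- s - 1) + - h)%C by ring.
      rewrite cpow_plus. ring.
  - intros t Ht. unfold w'. rewrite Cmod_mult, Cmod_cpow.
    destruct (ln_le_Rpower (Re s / 8) t) as [L0 L1]; [lra | exact Ht |]. fold A in L1.
    assert (Z : Cmod (- h * RtoC (ln t))%C = Cmod h * ln t).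
    { rewrite Cmod_mult, Cmod_opp, Cmod_R, Rabs_pos_eq by exact L0. reflexivity. }
    assert (X : exp (Cmod h * ln t) <= Rpower t (Re s / 4)).
    { apply Rpower_le_exponent; [exact Ht | exact Hh]. }
    assert (X0 := exp_pos (Cmod h * ln t)).
    pose proof (Cexp_bound2 (- h * RtoC (ln t))) as C2. rewrite Z in C2.
    pose proof (Cexp_bound1 (- h * RtoC (ln t)) 1) as C1.
    rewrite Cmult_1_r, Z in C1. specialize (C1 ltac:(lra)).
    fold (cpow t (- h)) in C1, C2. change (cpow t (- h)) with (E t) in C1, C2.
    set (q := Rpower t (Re s / 8)) in *.
    assert (Q1 : 1 <= q).
    { unfold q. rewrite <- (Rpower_O t) by lra. apply Rpower_le_exponent; lra. }
    assert (Q4 : Rpower t (Re s / 4) = q * q).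
    { unfold q. rewrite <- Rpower_plus. f_equal. field. }
    rewrite Q4 in X.
    replace (Re (- s - 1)%C) with (- 1 - Re s / 2 + - (Re s / 2)) by (unfold Re; simpl; field).
    rewrite Rpower_plus, Rmult_assoc, (Rmult_comm (K * _)).
    apply Rmult_le_compat_l; [left; apply exp_pos |].
    assert (I : Rpower t (- (Re s / 2)) * (q * q * (q * q)) = 1).
    { unfold q. rewrite <- !Rpower_plus. rewrite <- (Rpower_O t) by lra. f_equal. field. }
    assert (H0 := Cmod_ge_0 h). assert (S0 := Cmod_ge_0 s).
    assert (LL : ln t * ln t <= A * A * (q * q)).
    { replace (A * A * (q * q)) with ((A * q) * (A * q)) by ring.
      apply Rmult_le_compat; assumption. }
    assert (C2' : Cmod (E t - 1 - - h * RtoC (ln t))%C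
                  <= 4 * (Cmod h * Cmod h) * (A * A) * (q * q * (q * q))).
    { eapply Rle_trans; [exact C2 |].
      replace (4 * (Cmod h * ln t * (Cmod h * ln t) * exp (Cmod h * ln t)))
        with (4 * (Cmod h * Cmod h) * (ln t * ln t * exp (Cmod h * ln t))) by ring.
      rewrite (Rmult_assoc (4 * _)). apply Rmult_le_compat_l; [nra |].
      replace (A * A * (q * q * (q * q))) with (A * A * (q * q) * (q * q)) by ring.
      apply Rmult_le_compat; [nra | lra | exact LL | exact X]. }
    assert (C1' : Cmod (E t - 1)%C <= 2 * Cmod h * A * (q * q * (q * q))).
    { eapply Rle_trans; [exact C1 |].
      replace (2 * (Cmod h * ln t * exp (Cmod h * ln t)))
        with (2 * Cmod h * (ln t * exp (Cmod h * ln t))) by ring.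
      rewrite (Rmult_assoc (2 * _)). apply Rmult_le_compat_l; [lra |].
      apply Rle_trans with (A * q * (q * q)).
      - apply Rmult_le_compat; lra.
      - assert (0 <= A * q * (q * q)) by (repeat apply Rmult_le_pos; lra).
        replace (A * (q * q * (q * q))) with (A * q * (q * q) * q) by ring. nra. }
    assert (B : Cmod (- s * (E t - 1 - - h * RtoC (ln t)) + - h * (E t - 1))%C
                <= K * (Cmod h * Cmod h) * (q * q * (q * q))).
    { eapply Rle_trans; [apply Cmod_triangle |]. rewrite !Cmod_mult, !Cmod_opp.
      apply Rle_trans with
        (Cmod s * (4 * (Cmod h * Cmod h) * (A * A) * (q * q * (q * q)))
         + Cmod h * (2 * Cmod h * A * (q * q * (q * q)))).
      - apply Rplus_le_compat; apply Rmult_le_compat_l; assumption.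
      - right. unfold K. ring. }
    eapply Rle_trans; [apply Rmult_le_compat_l; [left; apply exp_pos | exact B] |].
    right. transitivity (K * (Cmod h * Cmod h) *
      (Rpower t (- (Re s / 2)) * (q * q * (q * q)))); [ring | rewrite I; ring].
  - assert (Ea : forall n, (w (INR (S n)) - (W (INR (S (S n))) - W (INR (S n))))%C = a n).
    { intro n. unfold a. rewrite !zeta_term_cprim. unfold dzeta_term, w, W. ring. }
    replace (CSeries a) with
      (CSeries (fun n => w (INR (S n)) - (W (INR (S (S n))) - W (INR (S n))))%C).
    + eapply Rle_trans; [exact B2 | right; ring].
    + symmetry. apply is_Cseries_unique. eapply is_Cseries_ext; [exact Ea | exact B1].
Qed.

Theorem zeta_holomorphic (s : C) : 0 < Re s -> s <> 1%C ->
  ex_derive (K := C_AbsRing) (V := C_NormedModule) zeta s.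
Proof.
  intros Hr Hs. destruct (zeta_series_quadratic s Hr Hs) as [K HK].
  assert (N : (s - 1)%C <> 0%C).
  { intro E. apply Hs. replace s with (s - 1 + 1)%C by ring. rewrite E. ring. }
  assert (N' := proj1 (Cmod_gt_0 _) N).
  set (m := Cmod (s - 1)%C) in *.
  exists (- / ((s - 1) * (s - 1)) + CSeries (dzeta_term s))%C.
  apply (is_Cderive_quadratic zeta s _ (Rmin (Re s / 4) (m / 2)) (2 / (m * m * m) + K)).
  - apply Rmin_pos; lra.
  - intros h Hh.
    assert (M1 := Rmin_l (Re s / 4) (m / 2)). assert (M2 := Rmin_r (Re s / 4) (m / 2)).
    assert (G : m / 2 <= Cmod (s + h - 1)%C).
    { assert (T := Cmod_triangle (s + h - 1) (- h)).
      replace (s + h - 1 + - h)%C with (s - 1)%C in T by ring.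
      rewrite Cmod_opp in T. fold m in T. lra. }
    assert (N2 : (s + h - 1)%C <> 0%C) by (apply Cmod_gt_0; lra).
    assert (Hsh : (s + h)%C <> 1%C) by (intro E; apply N2; rewrite E; ring).
    specialize (HK h ltac:(lra) Hsh).
    replace (zeta (s + h) - zeta s - h * (- / ((s - 1) * (s - 1)) + CSeries (dzeta_term s)))%C
      with (h * h / ((s - 1) * (s - 1) * (s + h - 1)) +
            (CSeries (zeta_term (s + h)) - CSeries (zeta_term s)
             - h * CSeries (dzeta_term s)))%C.
    2:{ unfold zeta. field. split; assumption. }
    eapply Rle_trans; [apply Cmod_triangle |].
    rewrite Rmult_plus_distr_r. apply Rplus_le_compat; [| exact HK].
    rewrite Cmod_div by (repeat apply Cmult_neq_0; assumption).
    rewrite !Cmod_mult. fold m.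
    unfold Rdiv. rewrite (Rmult_comm (Cmod h * Cmod h)).
    apply Rmult_le_compat_r; [apply Rle_0_sqr |].
    apply Rle_trans with (/ (m * m * (m / 2))).
    + apply Rinv_le_contravar; [repeat apply Rmult_lt_0_compat; lra |].
      apply Rmult_le_compat_l; [nra | exact G].
    + right. field. lra.
Qed.

(* Main.v *)
Require Import Defs.
From Stdlib Require Import Reals Lra Lia.
From Coquelicot Require Import Coquelicot.
Open Scope R_scope.

(* With kern phi v = cosh(phi v) / cosh(pi v), the integral of cos(a v) kern phi v
   over (0, oo) is cos(phi/2) cosh(a/2) / (cosh a + cos phi).  Approximating
   zeta(1/2 + iv) by sum_(m <= M) m^(-s) - M^(1-s) / (1-s) with an error
   O(|s|) tau_M, tau_M -> 0, and integrating termwise, the damped integral becomes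
     sqrt r cos(phi/2) (sum_(m <= M) g(m) - int_0^M g) + o(1),
     g(x) = (x + r) / (x^2 + 2 r x cos phi + r^2).
   The integral of g is elementary: its logarithmic part balances the sum up to a
   quantity bounded in M and phi as long as r is near 1 and r <> 1, while its
   arctangent part, with the factor cos(phi/2), tends to phi sin(phi/2).  Hence the
   damped integral is - sqrt r phi sin(phi/2) + O(cos(phi/2)), which tends to
   - pi sqrt r as phi -> pi. *)

(** * Exponentially dominated integrals over the half-line *)

(** The transform of the kernel is found without contour integration. Expanding 1 / cosh(pi v) in
    exponentials produces the frequencies (2 k + 1) pi, and the resulting terms are, up to a common
    factor, Fourier cosine coefficients on [0, 1/2] of an explicit function of x; Cesaro summation
    at x = 0 then yields the transform. The constant in the error bound for finite M blows up as phi
    -> pi, so M -> oo is taken at fixed phi, and only the estimate that survives has to be uniform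
    in phi. This uniformity is where r <> 1 enters: at r = 1 the term m = 1 is cos(phi/2) g(1) = 1 /
    (2 cos(phi/2)), which diverges as phi -> pi. A nonzero limit survives the vanishing prefactor
    because cos(phi/2) (1 - cos phi) = sin(phi/2) sin phi: in the primitive of cos(phi/2) g the
    logarithm keeps the factor cos(phi/2), but the arctangent carries sin(phi/2). *)

Notation is_int0 f l := (is_RInt_gen (V := R_NormedModule) f (at_point 0) (Rbar_locally p_infty) l).

Lemma ex_RInt_everywhere (f : R -> R) a b : (forall v, continuous f v) -> ex_RInt f a b.
Proof. intro H. apply (ex_RInt_continuous (V := R_CompleteNormedModule)). auto. Qed.

Lemma is_int0_lim (f : R -> R) (l : R) : (forall v, continuous f v) ->
  (is_int0 f l <-> is_lim (fun V => RInt f 0 V) p_infty l).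
Proof.
  intro Hc. split.
  - intros H P HP. specialize (H P HP). unfold filtermapi in H.
    destruct H as [Q R0 HQ HR H]. unfold filtermap.
    revert HR. apply filter_imp. intros V HV.
    destruct (H 0 V HQ HV) as [y [Hy1 Hy2]]. simpl in Hy1.
    rewrite (is_RInt_unique _ _ _ _ Hy1). exact Hy2.
  - intros H P HP. specialize (H P HP).
    exists (fun x => x = 0) (fun V => P (RInt f 0 V)).
    + reflexivity.
    + exact H.
    + intros x y -> Hy. exists (RInt f 0 y). split; [| exact Hy].
      simpl. apply (RInt_correct (V := R_CompleteNormedModule)), ex_RInt_everywhere, Hc.
Qed.

Lemma continuous_exp_lin (eta v : R) : continuous (fun v => exp (- eta * v)) v.
Proof. apply (ex_derive_continuous (K := R_AbsRing) (V := R_NormedModule)). auto_derive. auto. Qed.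

Lemma RInt_exp_lin (C eta a b : R) : 0 < eta ->
  is_RInt (fun v => C * exp (- eta * v)) a b (C / eta * (exp (- eta * a) - exp (- eta * b))).
Proof.
  intro He.
  replace (C / eta * (exp (- eta * a) - exp (- eta * b))) with
    (minus (- (C / eta) * exp (- eta * b)) (- (C / eta) * exp (- eta * a)))
    by (unfold minus, plus, opp; simpl; ring).
  apply (is_RInt_derive (V := R_CompleteNormedModule) (fun v => - (C / eta) * exp (- eta * v))).
  - intros x _. auto_derive; [auto | field; lra].
  - intros x _. apply (continuous_scal_r (K := R_AbsRing) (V := R_NormedModule) C), continuous_exp_lin.
Qed.

Lemma RInt_exp_dominated (f : R -> R) C eta a b : 0 < eta -> 0 <= a <= b ->
  (forall v, continuous f v) -> (forall v, 0 <= v -> Rabs (f v) <= C * exp (- eta * v)) ->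
  Rabs (RInt f a b) <= C / eta * (exp (- eta * a) - exp (- eta * b)).
Proof.
  intros He Hab Hc Hb.
  eapply (norm_RInt_le (V := R_NormedModule) f (fun v => C * exp (- eta * v)) a b); [lra | | |].
  - intros x Hx. apply Hb. lra.
  - apply (RInt_correct (V := R_CompleteNormedModule)), ex_RInt_everywhere, Hc.
  - apply RInt_exp_lin, He.
Qed.

Lemma is_lim_exp_lin eta : 0 < eta -> is_lim (fun v => exp (- eta * v)) p_infty 0.
Proof.
  intro He. apply (is_lim_comp exp (fun v => - eta * v) p_infty 0 m_infty).
  - apply is_lim_exp_m.
  - evar_last; [apply is_lim_scal_l, is_lim_id |].
    apply is_Rbar_mult_unique; unfold is_Rbar_mult; simpl.
    destruct (Rle_dec 0 (- eta)); [exfalso; lra | reflexivity].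
  - exists 0; intros; discriminate.
Qed.

(** The part of the integral beyond a is at most C / eta exp(- eta a): this gives the Cauchy
    criterion for existence, and a = 0 gives the bound. *)
Lemma exp_dominated_integral (f : R -> R) C eta : 0 < eta ->
  (forall v, continuous f v) -> (forall v, 0 <= v -> Rabs (f v) <= C * exp (- eta * v)) ->
  exists l, is_int0 f l /\ Rabs l <= C / eta.
Proof.
  intros He Hc Hb.
  assert (C0 : 0 <= C).
  { specialize (Hb 0 (Rle_refl _)). rewrite Rmult_0_r, exp_0 in Hb.
    pose proof (Rabs_pos (f 0)). lra. }
  assert (A : forall a b, 0 <= a <= b ->
    Rabs (RInt f a b) <= C / eta * exp (- eta * a)).
  { intros a b Hab. eapply Rle_trans; [apply (RInt_exp_dominated f C eta); assumption |].
    apply Rmult_le_compat_l.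
    - apply Rmult_le_pos; [exact C0 | left; apply Rinv_0_lt_compat, He].
    - pose proof (exp_pos (- eta * b)). lra. }
  assert (E : exists l : R, is_lim (fun V => RInt f 0 V) p_infty l).
  { apply (filterlim_locally_cauchy (U := R_CompleteSpace) (F := Rbar_locally p_infty)
      (fun V => RInt f 0 V)).
    intro eps.
    pose proof (is_lim_scal_l _ (C / eta) _ _ (is_lim_exp_lin eta He)) as L.
    simpl in L. rewrite Rmult_0_r in L.
    apply is_lim_spec in L. destruct (L eps) as [M HM].
    exists (fun V => Rmax M 0 < V). split; [exists (Rmax M 0); auto |].
    assert (W : forall u v, Rmax M 0 < u -> u <= v -> Rabs (RInt f 0 v - RInt f 0 u) < eps).
    { intros u v Hu Huv. pose proof (Rmax_l M 0). pose proof (Rmax_r M 0).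
      assert (S : RInt f 0 u + RInt f u v = RInt f 0 v).
      { apply (RInt_Chasles (V := R_CompleteNormedModule)); apply ex_RInt_everywhere, Hc. }
      rewrite <- S. replace (RInt f 0 u + RInt f u v - RInt f 0 u) with (RInt f u v)
        by (simpl; lra).
      eapply Rle_lt_trans; [apply A; lra |].
      specialize (HM u ltac:(lra)). rewrite Rminus_0_r in HM.
      eapply Rle_lt_trans; [apply Rle_abs | exact HM]. }
    intros u v Hu Hv. change (Rabs (RInt f 0 v - RInt f 0 u) < eps).
    destruct (Rle_dec u v) as [H | H].
    - apply W; assumption.
    - rewrite Rabs_minus_sym. apply W; [assumption | lra]. }
  destruct E as [l Hl]. exists l. split; [apply is_int0_lim; assumption |].
  apply (is_lim_le_loc (fun V => Rabs (RInt f 0 V)) (fun _ => C / eta) p_infty (Rabs l) (C / eta)).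
  - exists 0. intros V HV. eapply Rle_trans; [apply A; lra |].
    rewrite Rmult_0_r, exp_0, Rmult_1_r. apply Rle_refl.
  - exact (filterlim_comp _ _ _ (fun V => RInt f 0 V) Rabs _ _ _ Hl (continuous_Rabs l)).
  - apply is_lim_const.
Qed.

(** * The kernel and elementary integrals *)

Definition kern (phi v : R) : R := cosh (phi * v) / cosh (PI * v).

Lemma cosh_pos x : 0 < cosh x.
Proof. unfold cosh. pose proof (exp_pos x). pose proof (exp_pos (- x)). lra. Qed.

Lemma kern_pos phi v : 0 < kern phi v.
Proof. apply Rdiv_lt_0_compat; apply cosh_pos. Qed.

Lemma cosh_le_exp x y : Rabs x <= y -> cosh x <= exp y.
Proof.
  intro H. apply Rabs_le_between in H. unfold cosh.
  assert (exp x <= exp y) by (apply exp_le_mono; lra).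
  assert (exp (- x) <= exp y) by (apply exp_le_mono; lra). lra.
Qed.

Lemma kern_le_exp phi v : 0 <= v -> kern phi v <= 2 * exp (- (PI - Rabs phi) * v).
Proof.
  intro Hv. unfold kern. apply Rle_div_l; [apply cosh_pos |].
  apply Rle_trans with (exp (Rabs phi * v)).
  - apply cosh_le_exp. rewrite Rabs_mult, (Rabs_pos_eq v) by exact Hv. apply Rle_refl.
  - unfold cosh.
    replace (exp (Rabs phi * v)) with (exp (- (PI - Rabs phi) * v) * exp (PI * v))
      by (rewrite <- exp_plus; f_equal; ring).
    pose proof (exp_pos (- (PI - Rabs phi) * v)). pose proof (exp_pos (- (PI * v))).
    pose proof (exp_pos (PI * v)). nra.
Qed.

Lemma continuous_kern phi v : continuous (kern phi) v.
Proof.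
  apply (ex_derive_continuous (K := R_AbsRing) (V := R_NormedModule)).
  unfold kern, cosh. auto_derive.
  pose proof (exp_pos (PI * v)). pose proof (exp_pos (- (PI * v))). lra.
Qed.

Lemma continuous_Rmult (f g : R -> R) v :
  continuous f v -> continuous g v -> continuous (fun v => f v * g v) v.
Proof. apply (continuous_mult (K := R_AbsRing)). Qed.

Lemma kern_integral_bound phi : Rabs phi < PI -> exists B, 0 <= B /\ forall (f : R -> R) A,
  (forall v, continuous f v) -> (forall v, 0 <= v -> Rabs (f v) <= A * (1 + v)) ->
  exists l, is_int0 (fun v => f v * kern phi v) l /\ Rabs l <= A * B.
Proof.
  intro Hphi. pose (d := PI - Rabs phi). assert (Hd : 0 < d) by (unfold d; lra).
  assert (D0 : 0 < / d) by (apply Rinv_0_lt_compat, Hd).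
  (* The kernel is at most 2 exp(- d v); half of this decay absorbs the growth through 1 + v <= (1 +
     2 / d) exp(d v / 2). *)
  exists ((1 + 2 / d) * 2 / (d / 2)). split.
  { apply Rmult_le_pos; [unfold Rdiv; lra | left; apply Rinv_0_lt_compat; lra]. }
  intros f A Hc Hb.
  assert (A0 : 0 <= A).
  { specialize (Hb 0 (Rle_refl _)). pose proof (Rabs_pos (f 0)). lra. }
  replace (A * ((1 + 2 / d) * 2 / (d / 2))) with (A * ((1 + 2 / d) * 2) / (d / 2))
    by (field; lra).
  apply exp_dominated_integral; [lra | |].
  - intro v. apply continuous_Rmult; [apply Hc | apply continuous_kern].
  - intros v Hv. rewrite Rabs_mult, (Rabs_pos_eq (kern phi v)) by (left; apply kern_pos).
    rewrite Rmult_assoc.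
    apply Rle_trans with ((A * (1 + v)) * (2 * exp (- d * v))).
    + apply Rmult_le_compat; [apply Rabs_pos | left; apply kern_pos | apply Hb, Hv |].
      apply kern_le_exp, Hv.
    + rewrite Rmult_assoc. apply Rmult_le_compat_l; [exact A0 |].
      replace (exp (- d * v)) with (exp (- (d / 2) * v) * exp (- (d / 2) * v))
        by (rewrite <- exp_plus; f_equal; field).
      assert (1 + v <= (1 + 2 / d) * exp (d / 2 * v)).
      { pose proof (exp_ineq1_le (d / 2 * v)).
        assert (E : (1 + 2 / d) * (1 + d / 2 * v) = 1 + v + 2 / d + d / 2 * v) by (field; lra).
        assert (0 <= 2 / d) by (unfold Rdiv; lra).
        assert (0 <= d / 2 * v) by (apply Rmult_le_pos; lra). nra. }
      assert (I : exp (d / 2 * v) * exp (- (d / 2) * v) = 1)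
        by (rewrite <- exp_plus, <- exp_0; f_equal; ring).
      pose proof (exp_pos (- (d / 2) * v)) as E0.
      assert ((1 + v) * exp (- (d / 2) * v) <= 1 + 2 / d).
      { replace (1 + 2 / d) with ((1 + 2 / d) * exp (d / 2 * v) * exp (- (d / 2) * v))
          by (rewrite Rmult_assoc, I; ring).
        apply Rmult_le_compat_r; lra. }
      nra.
Qed.

Lemma is_int0_ext (f g : R -> R) l : (forall v, f v = g v) -> is_int0 f l -> is_int0 g l.
Proof.
  intro H. apply is_RInt_gen_ext. apply filter_forall. intros ab x _. apply H.
Qed.

Lemma is_int0_lincomb (f g : R -> R) (a b lf lg : R) : is_int0 f lf -> is_int0 g lg ->
  is_int0 (fun v => a * f v + b * g v) (a * lf + b * lg).
Proof.
  intros Hf Hg.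
  apply (is_RInt_gen_plus (V := R_NormedModule) (fun v => a * f v) (fun v => b * g v));
    apply (is_RInt_gen_scal (V := R_NormedModule)); assumption.
Qed.

Lemma is_int0_unique (f : R -> R) (l l' : R) : is_int0 f l -> is_int0 f l' -> l = l'.
Proof.
  intros H H'.
  rewrite <- (is_RInt_gen_unique (V := R_CompleteNormedModule) f l H).
  apply (is_RInt_gen_unique (V := R_CompleteNormedModule) f l' H').
Qed.

Lemma is_int0_exp_cos mu a : 0 < mu ->
  is_int0 (fun v => exp (- mu * v) * cos (a * v)) (mu / (mu * mu + a * a)).
Proof.
  intro Hm. assert (D : 0 < mu * mu + a * a) by nra.
  apply is_int0_lim.
  { intro v. apply (ex_derive_continuous (K := R_AbsRing) (V := R_NormedModule)).
    auto_derive. auto. }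
  pose (G := fun v => exp (- mu * v) * ((a * sin (a * v) - mu * cos (a * v)) / (mu * mu + a * a))).
  apply (is_lim_ext (fun V => G V - G 0)).
  { intro V. symmetry. apply is_RInt_unique.
    apply (is_RInt_derive (V := R_CompleteNormedModule) G).
    - intros x _. unfold G. auto_derive; [lra | field; lra].
    - intros x _. apply (ex_derive_continuous (K := R_AbsRing) (V := R_NormedModule)).
      auto_derive. auto. }
  replace (mu / (mu * mu + a * a)) with (0 - G 0).
  2:{ unfold G. rewrite !Rmult_0_r, exp_0, sin_0, cos_0. field. lra. }
  apply is_lim_minus'; [| apply is_lim_const].
  pose (B := (Rabs a + mu) / (mu * mu + a * a)).
  assert (L : is_lim (fun v => exp (- mu * v) * B) p_infty 0).
  { replace (Finite 0) with (Rbar_mult 0 B) by (simpl; f_equal; ring).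
    apply is_lim_scal_r, is_lim_exp_lin, Hm. }
  apply (is_lim_le_le_loc (fun v => - (exp (- mu * v) * B)) (fun v => exp (- mu * v) * B)).
  - exists 0. intros v _. apply Rabs_le_between. unfold G, B.
    rewrite Rabs_mult, (Rabs_pos_eq (exp _)) by (left; apply exp_pos).
    apply Rmult_le_compat_l; [left; apply exp_pos |].
    unfold Rdiv. rewrite Rabs_mult, (Rabs_pos_eq (/ _)) by (left; apply Rinv_0_lt_compat, D).
    apply Rmult_le_compat_r; [left; apply Rinv_0_lt_compat, D |].
    apply Rle_trans with (Rabs (a * sin (a * v)) + Rabs (mu * cos (a * v))).
    + unfold Rminus. eapply Rle_trans; [apply Rabs_triang |]. rewrite Rabs_Ropp. lra.
    + rewrite !Rabs_mult, (Rabs_pos_eq mu) by lra.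
      assert (Rabs (sin (a * v)) <= 1) by (apply Rabs_le, SIN_bound).
      assert (Rabs (cos (a * v)) <= 1) by (apply Rabs_le, COS_bound).
      pose proof (Rabs_pos a). nra.
  - rewrite <- (Rbar_opp_involutive 0). simpl. rewrite Ropp_0.
    replace (Finite 0) with (Rbar_opp 0) by (simpl; f_equal; ring).
    apply (is_lim_opp _ _ 0), L.
  - exact L.
Qed.

Lemma is_int0_exp_cosh_cos c phi a : Rabs phi < c ->
  is_int0 (fun v => cos (a * v) * cosh (phi * v) * exp (- c * v))
    (((c - phi) / ((c - phi) * (c - phi) + a * a)
      + (c + phi) / ((c + phi) * (c + phi) + a * a)) / 2).
Proof.
  intro H. apply Rabs_lt_between in H.
  replace (_ / 2) with (/ 2 * ((c - phi) / ((c - phi) * (c - phi) + a * a))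
    + / 2 * ((c + phi) / ((c + phi) * (c + phi) + a * a))) by (field; split; nra).
  eapply is_int0_ext.
  2:{ apply (is_int0_lincomb (fun v => exp (- (c - phi) * v) * cos (a * v))
        (fun v => exp (- (c + phi) * v) * cos (a * v))); apply is_int0_exp_cos; lra. }
  intro v. unfold cosh.
  replace (- (c - phi) * v) with (phi * v + - c * v) by ring.
  replace (- (c + phi) * v) with (- (phi * v) + - c * v) by ring.
  rewrite !exp_plus. field.
Qed.

(** The integrand 1 / cosh(pi v) has the primitive - (2 / pi) atan(exp(- pi v)), which is - 1/2 at 0
    and tends to 0 at infinity. *)
Lemma is_int0_kern_0 : is_int0 (fun v => cos (0 * v) * kern 0 v) (1 / 2).
Proof.
  assert (HP := PI_RGT_0).
  apply (is_int0_ext (fun v => 2 / (exp (PI * v) + exp (- (PI * v))))).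
  { intro v. unfold kern, cosh. rewrite !Rmult_0_l, cos_0, Ropp_0, exp_0. field.
    pose proof (exp_pos (PI * v)). pose proof (exp_pos (- (PI * v))). lra. }
  assert (D : forall v, ex_derive (fun v => 2 / (exp (PI * v) + exp (- (PI * v)))) v).
  { intro v. auto_derive. pose proof (exp_pos (PI * v)). pose proof (exp_pos (- (PI * v))). lra. }
  apply is_int0_lim.
  { intro v. apply (ex_derive_continuous (K := R_AbsRing) (V := R_NormedModule)), D. }
  pose (G := fun v => - (2 / PI) * atan (exp (- PI * v))).
  apply (is_lim_ext (fun V => G V - G 0)).
  { intro V. symmetry. apply is_RInt_unique.
    apply (is_RInt_derive (V := R_CompleteNormedModule) G).
    - intros x _. unfold G. auto_derive; [auto |].
      replace (- PI * x) with (- (PI * x)) by ring. rewrite exp_Ropp.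
      pose proof (exp_pos (PI * x)). field. repeat split; nra.
    - intros x _. apply (ex_derive_continuous (K := R_AbsRing) (V := R_NormedModule)), D. }
  replace (1 / 2) with (- (2 / PI) * 0 - G 0).
  2:{ unfold G. rewrite !Rmult_0_r, exp_0, atan_1. field. lra. }
  apply is_lim_minus'; [| apply is_lim_const].
  apply (is_lim_scal_l (fun v => atan (exp (- PI * v))) (- (2 / PI)) p_infty 0).
  rewrite <- atan_0.
  exact (filterlim_comp _ _ _ (fun v => exp (- PI * v)) atan _ _ _
    (is_lim_exp_lin PI HP) (ex_derive_continuous (K := R_AbsRing) (V := R_NormedModule)
      atan 0 (ex_intro _ _ (is_derive_atan 0)))).
Qed.

(** * The Fourier transform of the kernel *)

(** The frequencies are the exponents in 1 / cosh(pi v) = 2 sum_(k >= 0) (-1)^k exp(- (2 k + 1) pi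
    v). Being odd multiples of pi, they sum to sin(2 n pi x) / sin(pi x). *)
Fixpoint dirichlet (n : nat) (x : R) : R :=
  match n with
  | O => 0
  | S n => dirichlet n x + 2 * cos ((2 * INR n + 1) * PI * x)
  end.

(** A sum, not an average: the division by n comes later, so a bound uniform in n as in
    [fejer_small] is enough. Unlike the classical Fejer kernel it need not be positive. *)
Fixpoint fejer (n : nat) (x : R) : R :=
  match n with
  | O => 0
  | S n => fejer n x + dirichlet n x
  end.

Lemma dirichlet_sin n x : sin (PI * x) * dirichlet n x = sin (2 * INR n * PI * x).
Proof.
  induction n as [| n IH].
  - simpl. rewrite !Rmult_0_r, !Rmult_0_l, sin_0. reflexivity.
  - cbn [dirichlet]. rewrite Rmult_plus_distr_l, IH, S_INR.
    replace (2 * INR n * PI * x) with ((2 * INR n + 1) * PI * x - PI * x) by ring.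
    replace (2 * (INR n + 1) * PI * x) with ((2 * INR n + 1) * PI * x + PI * x) by ring.
    rewrite sin_minus, sin_plus. ring.
Qed.

Lemma fejer_sin n x : 2 * (sin (PI * x) * sin (PI * x)) * fejer n x
  = cos (PI * x) - cos ((2 * INR n - 1) * PI * x).
Proof.
  induction n as [| n IH].
  - simpl. replace ((2 * 0 - 1) * PI * x) with (- (PI * x)) by ring. rewrite cos_neg. ring.
  - cbn [fejer]. rewrite Rmult_plus_distr_l, IH, S_INR.
    replace (2 * (sin (PI * x) * sin (PI * x)) * dirichlet n x)
      with (2 * sin (PI * x) * (sin (PI * x) * dirichlet n x)) by ring.
    rewrite dirichlet_sin.
    replace ((2 * (INR n + 1) - 1) * PI * x) with (2 * INR n * PI * x + PI * x) by ring.
    replace ((2 * INR n - 1) * PI * x) with (2 * INR n * PI * x - PI * x) by ring.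
    rewrite cos_minus, cos_plus. ring.
Qed.

Lemma continuous_dirichlet n x : continuous (dirichlet n) x.
Proof.
  induction n as [| n IH].
  - apply continuous_const.
  - apply (continuous_plus (V := R_NormedModule) (dirichlet n)); [exact IH |].
    apply (ex_derive_continuous (K := R_AbsRing) (V := R_NormedModule)). auto_derive. auto.
Qed.

Lemma continuous_fejer n x : continuous (fejer n) x.
Proof.
  induction n as [| n IH].
  - apply continuous_const.
  - apply (continuous_plus (V := R_NormedModule) (fejer n)); [exact IH |].
    apply continuous_dirichlet.
Qed.

Lemma sin_ge_quarter y : 0 <= y <= PI / 2 -> y / 4 <= sin y.
Proof.
  intros [H0 H1]. assert (P4 := PI_4).
  destruct (SIN y H0 ltac:(lra)) as [H _]. eapply Rle_trans; [| exact H].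
  unfold sin_lb, sin_approx, sin_term. simpl.
  (* The crude PI <= 4 suffices: with y^2 <= 4 the factor 1 - y^2 / 6 is still at least 1/3. *)
  assert (U : 0 <= y * y <= 4) by nra.
  match goal with |- _ <= ?e =>
    replace e with (y * (1 - y * y / 6 + (y * y) * (y * y) / 120 * (1 - y * y / 42)))
      by (field) end.
  assert (0 <= (y * y) * (y * y) / 120 * (1 - y * y / 42)) by
    (apply Rmult_le_pos; [nra | lra]).
  nra.
Qed.

(* Cesaro means are used so that |f| <= C x^2 suffices: no Riemann-Lebesgue argument
   is then needed. *)
Lemma fejer_small (f : R -> R) C n : 0 <= C -> (forall x, continuous f x) ->
  (forall x, 0 <= x <= 1 / 2 -> Rabs (f x) <= C * (x * x)) ->
  Rabs (RInt (fun x => f x * fejer n x) 0 (1 / 2)) <= 2 * C.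
Proof.
  intros C0 Hc Hb. assert (HP := PI_RGT_0).
  eapply Rle_trans.
  - apply (abs_RInt_le_const _ 0 (1 / 2) (4 * C)); [lra | |].
    + apply ex_RInt_everywhere. intro v. apply continuous_Rmult; [apply Hc | apply continuous_fejer].
    + intros x Hx. rewrite Rabs_mult. specialize (Hb x Hx).
      destruct (Req_dec x 0) as [-> | Nx].
      { replace (Rabs (f 0)) with 0; [nra |]. pose proof (Rabs_pos (f 0)). nra. }
      (* This gives sin^2(pi x) >= x^2 / 4, which the factor x^2 in the bound on f compensates; the
         integrand is then at most 4 C on an interval of length 1/2. *)
      assert (S1 : x / 2 <= sin (PI * x)).
      { assert (Q := sin_ge_quarter (PI * x) ltac:(nra)). assert (P2 := PI2_1). nra. }
      assert (A := fejer_sin n x). pose proof (COS_bound (PI * x)).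
      pose proof (COS_bound ((2 * INR n - 1) * PI * x)).
      assert (S2 : x * x / 4 <= sin (PI * x) * sin (PI * x)) by nra.
      assert (B : sin (PI * x) * sin (PI * x) * Rabs (fejer n x) <= 1).
      { rewrite <- (Rabs_pos_eq (sin (PI * x) * sin (PI * x))) by nra.
        rewrite <- Rabs_mult. apply Rabs_le. lra. }
      pose proof (Rabs_pos (fejer n x)). pose proof (Rabs_pos (f x)).
      apply Rle_trans with (C * (x * x) * Rabs (fejer n x)); [nra |].
      assert (x * x / 4 * Rabs (fejer n x) <= 1) by nra. nra.
  - lra.
Qed.

Lemma fejer_cesaro (f : R -> R) n : (forall x, continuous f x) ->
  RInt (fun x => f x * fejer (S n) x) 0 (1 / 2)
  = sum_f_R0 (fun k => RInt (fun x => f x * dirichlet k x) 0 (1 / 2)) n.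
Proof.
  intro Hc.
  assert (E : forall k, ex_RInt (fun x => f x * dirichlet k x) 0 (1 / 2)).
  { intro k. apply ex_RInt_everywhere. intro x.
    apply continuous_Rmult; [apply Hc | apply continuous_dirichlet]. }
  assert (E' : forall k, ex_RInt (fun x => f x * fejer k x) 0 (1 / 2)).
  { intro k. apply ex_RInt_everywhere. intro x.
    apply continuous_Rmult; [apply Hc | apply continuous_fejer]. }
  assert (St : forall k, RInt (fun x => f x * fejer (S k) x) 0 (1 / 2) =
    RInt (fun x => f x * fejer k x) 0 (1 / 2) + RInt (fun x => f x * dirichlet k x) 0 (1 / 2)).
  { intro k. rewrite <- (RInt_plus (V := R_CompleteNormedModule)) by auto.
    apply RInt_ext. intros x _. unfold plus; simpl.
    match goal with |- ?a = ?b => change (@eq R a b) end. ring. }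
  induction n as [| n IH].
  - rewrite St. simpl.
    rewrite (RInt_ext (fun x => f x * 0) (fun _ => 0)) by (intros; match goal with |- ?a = ?b => change (@eq R a b) end; ring).
    rewrite RInt_const. unfold scal; simpl. unfold mult; simpl. ring.
  - rewrite St, IH. reflexivity.
Qed.

Lemma cos_sin_half_odd_PI n :
  cos ((2 * INR n + 1) * PI / 2) = 0 /\ sin ((2 * INR n + 1) * PI / 2) = (- 1) ^ n.
Proof.
  induction n as [| n [IH1 IH2]].
  - simpl. replace ((2 * 0 + 1) * PI / 2) with (PI / 2) by field.
    rewrite cos_PI2, sin_PI2. split; reflexivity.
  - rewrite S_INR.
    replace ((2 * (INR n + 1) + 1) * PI / 2) with ((2 * INR n + 1) * PI / 2 + PI) by field.
    rewrite neg_cos, neg_sin, IH1, IH2. split; simpl; ring.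
Qed.

(* cos((phi - i a) / 2) = trans_p + i trans_q; the function below is the real part of
   (trans_p + i trans_q) cos((phi + i a) x). *)
Definition trans_p (phi a : R) := cos (phi / 2) * cosh (a / 2).
Definition trans_q (phi a : R) := sin (phi / 2) * sinh (a / 2).
Definition trans_fun (phi a x : R) : R :=
  trans_p phi a * (cos (phi * x) * cosh (a * x)) + trans_q phi a * (sin (phi * x) * sinh (a * x)).

Lemma continuous_trans_fun phi a x : continuous (trans_fun phi a) x.
Proof.
  apply (ex_derive_continuous (K := R_AbsRing) (V := R_NormedModule)).
  unfold trans_fun. auto_derive. auto.
Qed.

(** Put z = phi + i a. Since c / 2 is an odd multiple of pi / 2, the integral of cos(z x) cos(c x)
    over [0, 1/2] is (-1)^n cos(z / 2) (1 / (c - z) + 1 / (c + z)) / 2. The prefactor in [trans_fun]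
    is the conjugate of cos(z / 2), so the product is a squared modulus times a quantity whose real
    part is the integral of [is_int0_exp_cosh_cos]. *)
Lemma RInt_trans_fun_cos phi a n : Rabs phi < PI -> let c := (2 * INR n + 1) * PI in
  RInt (fun x => trans_fun phi a x * cos (c * x)) 0 (1 / 2)
  = (trans_p phi a * trans_p phi a + trans_q phi a * trans_q phi a) * ((- 1) ^ n *
    (((c - phi) / ((c - phi) * (c - phi) + a * a)
      + (c + phi) / ((c + phi) * (c + phi) + a * a)) / 2)).
Proof.
  intros H c.
  assert (Hc : Rabs phi < c).
  { unfold c. pose proof (pos_INR n). pose proof PI_RGT_0. nra. }
  apply Rabs_lt_between in Hc.
  set (p := trans_p phi a). set (q := trans_q phi a).
  assert (D1 : 0 < (c - phi) * (c - phi) + a * a) by nra.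
  assert (D2 : 0 < (c + phi) * (c + phi) + a * a) by nra.
  (* [A m] and [B m] are primitives of p cos(m x) cosh(a x) and q sin(m x) sinh(a x); the product
     formulas split the integrand into the frequencies c + phi and c - phi. *)
  pose (A := fun m x => (p * (m * sin (m * x) * cosh (a * x) + a * cos (m * x) * sinh (a * x))
     / (m * m + a * a))).
  pose (B := fun m x => (q * (a * sin (m * x) * cosh (a * x) - m * cos (m * x) * sinh (a * x))
     / (m * m + a * a))).
  pose (G := fun x => (A (c + phi) x + A (c - phi) x + B (c + phi) x - B (c - phi) x) / 2).
  assert (I : is_RInt (fun x => trans_fun phi a x * cos (c * x)) 0 (1 / 2) (minus (G (1 / 2)) (G 0))).
  { apply (is_RInt_derive (V := R_CompleteNormedModule) G).
    - intros x _. unfold G, A, B, trans_fun. fold p q. auto_derive; [auto |].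
      replace ((c + phi) * x) with (c * x + phi * x) by ring.
      replace ((c - phi) * x) with (c * x - phi * x) by ring.
      rewrite cos_plus, cos_minus, sin_plus, sin_minus. field. lra.
    - intros x _. apply continuous_Rmult; [apply continuous_trans_fun |].
      apply (ex_derive_continuous (K := R_AbsRing) (V := R_NormedModule)). auto_derive. auto. }
  rewrite (is_RInt_unique _ _ _ _ I). unfold minus, plus, opp; simpl.
  destruct (cos_sin_half_odd_PI n) as [Z1 Z2]. fold c in Z1, Z2.
  unfold G, A, B. rewrite !Rmult_0_r, sin_0, sinh_0.
  replace ((c + phi) * (1 / 2)) with (c / 2 + phi / 2) by field.
  replace ((c - phi) * (1 / 2)) with (c / 2 - phi / 2) by field.
  replace (a * (1 / 2)) with (a / 2) by field.
  rewrite cos_plus, cos_minus, sin_plus, sin_minus, Z1, Z2.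
  unfold p, q, trans_p, trans_q. field. lra.
Qed.

(* Multiplying the kernel by 1 - (-1)^n e^(-2 n pi v) truncates its expansion in
   exponentials to n terms; the factor (-1)^n e is the remainder. *)
Lemma RInt_trans_fun_dirichlet phi a T : Rabs phi < PI ->
  is_int0 (fun v => cos (a * v) * kern phi v) T -> forall n, exists e,
  is_int0 (fun v => cos (a * v) * kern phi v * exp (- (2 * INR n * PI) * v)) e /\
  RInt (fun x => trans_fun phi a x * dirichlet n x) 0 (1 / 2)
  = (trans_p phi a * trans_p phi a + trans_q phi a * trans_q phi a) * (T - (- 1) ^ n * e).
Proof.
  intros H HT. induction n as [| n [e [IH1 IH2]]].
  - exists T. split.
    + eapply is_int0_ext; [| exact HT]. intro v. simpl.
      replace (- (2 * 0 * PI) * v) with 0 by ring. rewrite exp_0. ring.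
    + simpl. rewrite (RInt_ext _ (fun _ => 0)).
      * rewrite RInt_const. unfold scal; simpl; unfold mult; simpl. ring.
      * intros x _. match goal with |- ?u = ?w => change (@eq R u w) end. ring.
  - pose (c := (2 * INR n + 1) * PI).
    pose (Rc := (((c - phi) / ((c - phi) * (c - phi) + a * a)
      + (c + phi) / ((c + phi) * (c + phi) + a * a)) / 2)).
    assert (Hc : Rabs phi < c).
    { unfold c. pose proof (pos_INR n). pose proof PI_RGT_0. nra. }
    (* Since 2 cosh(pi v) exp(- c v) = exp(- 2 n pi v) + exp(- 2 (n + 1) pi v), two consecutive
       remainders add up to 2 [Rc]. *)
    exists (2 * Rc + - (1) * e). split.
    + eapply is_int0_ext.
      2:{ apply is_int0_lincomb; [apply (is_int0_exp_cosh_cos c phi a Hc) | exact IH1]. }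
      intro v. cbv beta. rewrite S_INR. unfold kern.
      assert (E1 : exp (- (2 * INR n * PI) * v) = exp (- c * v) * exp (PI * v))
        by (unfold c; rewrite <- exp_plus; f_equal; ring).
      assert (E2 : exp (- (2 * (INR n + 1) * PI) * v) = exp (- c * v) * exp (- (PI * v)))
        by (unfold c; rewrite <- exp_plus; f_equal; ring).
      rewrite E1, E2. pose proof (cosh_pos (PI * v)) as P.
      unfold Rdiv. apply Rmult_eq_reg_r with (cosh (PI * v)); [| lra].
      field_simplify; [| lra | lra]. unfold cosh. field.
    + cbn [dirichlet].
      rewrite (RInt_ext _ (fun x => plus (trans_fun phi a x * dirichlet n x)
        (scal 2 (trans_fun phi a x * cos ((2 * INR n + 1) * PI * x))))).
      2:{ intros x _. unfold plus, scal; simpl; unfold mult; simpl.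
          match goal with |- ?u = ?w => change (@eq R u w) end. ring. }
      assert (C : forall m x, continuous (fun x => trans_fun phi a x * cos (m * x)) x).
      { intros m x. apply continuous_Rmult; [apply continuous_trans_fun |].
        apply (ex_derive_continuous (K := R_AbsRing) (V := R_NormedModule)). auto_derive. auto. }
      rewrite (RInt_plus (V := R_CompleteNormedModule)), (RInt_scal (V := R_CompleteNormedModule)).
      * rewrite IH2, (RInt_trans_fun_cos phi a n H). fold c Rc.
        unfold plus, scal; simpl; unfold mult; simpl. ring.
      * apply ex_RInt_everywhere, C.
      * apply ex_RInt_everywhere. intro x.
        apply continuous_Rmult; [apply continuous_trans_fun | apply continuous_dirichlet].
      * apply (ex_RInt_scal (V := R_NormedModule)), ex_RInt_everywhere, C.
Qed.

(** * Evaluation of the transform through Cesaro means *)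

Lemma is_lim_seq_INR_inv : is_lim_seq (fun n => / INR n) 0.
Proof. apply (is_lim_seq_inv INR p_infty is_lim_seq_INR). discriminate. Qed.

Lemma Rabs_sin_le x : 0 <= x -> forall m, Rabs (sin (m * x)) <= Rabs m * x.
Proof.
  intros Hx m.
  assert (P : forall y, 0 <= y -> Rabs (sin y) <= y).
  { intros y Hy. replace (sin y) with (sin y - sin 0) by (rewrite sin_0; ring).
    replace y with (1 * (y - 0)) at 2 by ring.
    apply (real_MVI sin cos); [exact Hy | |].
    - intros t _. apply is_derive_sin.
    - intros t _. apply Rabs_le, COS_bound. }
  replace (Rabs m * x) with (Rabs (m * x)) by (rewrite Rabs_mult, (Rabs_pos_eq x) by exact Hx; ring).
  destruct (Rle_dec 0 (m * x)) as [H | H].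
  - rewrite (Rabs_pos_eq (m * x)) by exact H. apply P, H.
  - rewrite (Rabs_left (m * x)) by lra.
    replace (m * x) with (- (- (m * x))) at 1 by ring.
    rewrite sin_neg, Rabs_Ropp. apply P. lra.
Qed.

Lemma Rabs_sinh_le a x : 0 <= x <= 1 -> Rabs (sinh (a * x)) <= Rabs a * x * exp (Rabs a).
Proof.
  intro Hx.
  replace (sinh (a * x)) with (sinh (a * x) - sinh (a * 0)) by (rewrite Rmult_0_r, sinh_0; ring).
  replace (Rabs a * x * exp (Rabs a)) with (Rabs a * exp (Rabs a) * (x - 0)) by ring.
  apply (real_MVI (fun t => sinh (a * t)) (fun t => a * cosh (a * t))); [lra | |].
  - intros t _. auto_derive; [auto | ring].
  - intros t Ht. rewrite Rabs_mult. apply Rmult_le_compat_l; [apply Rabs_pos |].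
    rewrite Rabs_pos_eq by (left; apply cosh_pos).
    apply cosh_le_exp. rewrite Rabs_mult, (Rabs_pos_eq t) by lra. pose proof (Rabs_pos a). nra.
Qed.

(** The function is even in x, so it has no linear term at 0: its derivative consists of products
    sin cosh and cos sinh, each O(x). *)
Lemma trans_fun_quadratic phi a : exists K, 0 <= K /\ forall x, 0 <= x <= 1 / 2 ->
  Rabs (trans_fun phi a x - trans_p phi a) <= K * (x * x).
Proof.
  set (p := trans_p phi a). set (q := trans_q phi a). set (M := exp (Rabs a)).
  assert (M0 : 0 < M) by apply exp_pos.
  pose (K := Rabs p * (Rabs phi * (Rabs phi * M) + Rabs a * (Rabs a * M))
             + Rabs q * (Rabs phi * (Rabs a * M) + Rabs a * (Rabs phi * M))).
  assert (K0 : 0 <= K).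
  { unfold K. repeat (apply Rplus_le_le_0_compat || apply Rmult_le_pos); try apply Rabs_pos; lra. }
  exists K. split; [exact K0 |]. intros x Hx.
  replace p with (trans_fun phi a 0).
  2:{ unfold trans_fun. fold p q. rewrite !Rmult_0_r, cos_0, sin_0, cosh_0. ring. }
  replace (K * (x * x)) with (K * x * (x - 0)) by ring.
  apply (real_MVI (trans_fun phi a) (fun t =>
    p * (- phi * (sin (phi * t) * cosh (a * t)) + a * (cos (phi * t) * sinh (a * t)))
    + q * (phi * (cos (phi * t) * sinh (a * t)) + a * (sin (phi * t) * cosh (a * t))))); [lra | |].
  - intros t _. unfold trans_fun. fold p q. auto_derive; [auto | ring].
  - intros t Ht.
    assert (Ch : Rabs (cosh (a * t)) <= M).
    { rewrite Rabs_pos_eq by (left; apply cosh_pos).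
      apply cosh_le_exp. rewrite Rabs_mult, (Rabs_pos_eq t) by lra. pose proof (Rabs_pos a). nra. }
    assert (Cs : Rabs (cos (phi * t)) <= 1) by (apply Rabs_le, COS_bound).
    assert (U : Rabs (sin (phi * t) * cosh (a * t)) <= Rabs phi * M * x).
    { rewrite Rabs_mult. apply Rle_trans with (Rabs phi * t * M).
      - apply Rmult_le_compat; [apply Rabs_pos | apply Rabs_pos | apply Rabs_sin_le; lra | exact Ch].
      - assert (0 <= Rabs phi * M) by (apply Rmult_le_pos; [apply Rabs_pos | lra]). nra. }
    assert (W : Rabs (cos (phi * t) * sinh (a * t)) <= Rabs a * M * x).
    { rewrite Rabs_mult. apply Rle_trans with (1 * (Rabs a * t * M)).
      - apply Rmult_le_compat; [apply Rabs_pos | apply Rabs_pos | exact Cs | apply Rabs_sinh_le; lra].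
      - assert (0 <= Rabs a * M) by (apply Rmult_le_pos; [apply Rabs_pos | lra]). nra. }
    assert (T : forall m n u v S S', Rabs u <= S -> Rabs v <= S' ->
      Rabs (m * u + n * v) <= Rabs m * S + Rabs n * S').
    { intros m n u v S S' Hu Hv. eapply Rle_trans; [apply Rabs_triang |]. rewrite !Rabs_mult.
      apply Rplus_le_compat; (apply Rmult_le_compat_l; [apply Rabs_pos | assumption]). }
    eapply Rle_trans; [apply T; apply T; [exact U | exact W | exact W | exact U] |].
    rewrite Rabs_Ropp. right. unfold K. ring.
Qed.

(** The kernel is at most 2, so the remainder after n exponentials is at most 1 / (pi n) and the
    Dirichlet integrals themselves converge to this limit. Averaging preserves the limit and makes
    it accessible to [fejer_small]. *)
Lemma is_lim_seq_transform phi a T : Rabs phi < PI ->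
  is_int0 (fun v => cos (a * v) * kern phi v) T ->
  is_lim_seq (fun n => RInt (fun x => trans_fun phi a x * fejer n x) 0 (1 / 2) / INR n)
    ((trans_p phi a * trans_p phi a + trans_q phi a * trans_q phi a) * T).
Proof.
  intros H HT.
  set (Y := trans_p phi a * trans_p phi a + trans_q phi a * trans_q phi a).
  assert (HP := PI_RGT_0).
  assert (L : is_lim_seq (fun n => RInt (fun x => trans_fun phi a x * dirichlet n x) 0 (1 / 2)) (Y * T)).
  { apply is_lim_seq_incr_1.
    apply (is_lim_seq_le_le (fun n => Y * T - Rabs Y * / PI * / INR (S n)) _
             (fun n => Y * T + Rabs Y * / PI * / INR (S n))).
    - intro n. destruct (RInt_trans_fun_dirichlet phi a T H HT (S n)) as [e [E1 E2]].
      fold Y in E2. rewrite E2.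
      assert (N0 : 0 < INR (S n)) by (apply lt_0_INR; lia).
      destruct (exp_dominated_integral
        (fun v => cos (a * v) * kern phi v * exp (- (2 * INR (S n) * PI) * v)) 2 (2 * INR (S n) * PI))
        as [e' [E3 E4]].
      + nra.
      + intro v. apply continuous_Rmult; [apply continuous_Rmult; [| apply continuous_kern] |
          apply continuous_exp_lin].
        apply (ex_derive_continuous (K := R_AbsRing) (V := R_NormedModule)). auto_derive. auto.
      + intros v Hv. rewrite Rabs_mult, (Rabs_pos_eq (exp _)) by (left; apply exp_pos).
        apply Rmult_le_compat_r; [left; apply exp_pos |].
        rewrite Rabs_mult, (Rabs_pos_eq (kern _ _)) by (left; apply kern_pos).
        assert (K2 : kern phi v <= 2).
        { eapply Rle_trans; [apply kern_le_exp, Hv |].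
          assert (exp (- (PI - Rabs phi) * v) <= exp 0) by (apply exp_le_mono; nra).
          rewrite exp_0 in *. lra. }
        assert (C1 : Rabs (cos (a * v)) <= 1) by (apply Rabs_le, COS_bound).
        pose proof (Rabs_pos (cos (a * v))). pose proof (kern_pos phi v). nra.
      + rewrite <- (is_int0_unique _ _ _ E1 E3) in E4.
        replace (2 / (2 * INR (S n) * PI)) with (/ PI * / INR (S n)) in E4 by (field; lra).
        assert (B : Rabs (Y * ((- 1) ^ S n * e)) <= Rabs Y * / PI * / INR (S n)).
        { rewrite !Rabs_mult, pow_1_abs, Rmult_1_l, Rmult_assoc.
          apply Rmult_le_compat_l; [apply Rabs_pos | exact E4]. }
        apply Rabs_le_between in B. lra.
    - replace (Finite (Y * T)) with (Finite (Y * T - Rabs Y * / PI * 0)) by (f_equal; ring).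
      apply is_lim_seq_minus'; [apply is_lim_seq_const |].
      apply (is_lim_seq_scal_l _ (Rabs Y * / PI) 0).
      apply (is_lim_seq_incr_1 (fun n => / INR n)), is_lim_seq_INR_inv.
    - replace (Finite (Y * T)) with (Finite (Y * T + Rabs Y * / PI * 0)) by (f_equal; ring).
      apply is_lim_seq_plus'; [apply is_lim_seq_const |].
      apply (is_lim_seq_scal_l _ (Rabs Y * / PI) 0).
      apply (is_lim_seq_incr_1 (fun n => / INR n)), is_lim_seq_INR_inv. }
  (* [Cesaro_1] divides the sum up to pred n by n; the shift by one below turns this into the sum in
     [fejer_cesaro] and avoids n = 0. *)
  apply is_lim_seq_Reals in L. apply Cesaro_1 in L. apply is_lim_seq_Reals in L.
  apply is_lim_seq_incr_1. apply -> is_lim_seq_incr_1 in L.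
  eapply is_lim_seq_ext; [| exact L].
  intro n. cbv beta. rewrite fejer_cesaro by (apply continuous_trans_fun). reflexivity.
Qed.

(* The normalisation of the kernel is read off the case phi = a = 0, where the transform
   is the elementary integral of 1 / cosh(pi v). *)
Lemma fejer_mass : is_lim_seq (fun n => RInt (fejer n) 0 (1 / 2) / INR n) (1 / 2).
Proof.
  assert (P : Rabs 0 < PI) by (rewrite Rabs_R0; apply PI_RGT_0).
  assert (L := is_lim_seq_transform 0 0 (1 / 2) P is_int0_kern_0).
  replace (_ * (1 / 2)) with (1 / 2) in L.
  2:{ unfold trans_p, trans_q. replace (0 / 2) with 0 by field.
      rewrite cos_0, cosh_0, sin_0. ring. }
  eapply is_lim_seq_ext; [| exact L].
  intro n. cbv beta. f_equal. apply RInt_ext. intros x _.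
  unfold trans_fun, trans_p, trans_q. replace (0 / 2) with 0 by field.
  rewrite !Rmult_0_l, cos_0, cosh_0, sin_0.
  match goal with |- ?u = ?w => change (@eq R u w) end. ring.
Qed.

Lemma cosh_plus_cos_pos phi a : Rabs phi < PI -> 0 < cosh a + cos phi.
Proof.
  intro H. apply Rabs_lt_between in H.
  assert (C : 0 < cos (phi / 2)) by (apply cos_gt_0; lra).
  assert (E := cos_2a_cos (phi / 2)). replace (2 * (phi / 2)) with phi in E by field.
  assert (Ch : 1 <= cosh a).
  { unfold cosh. pose proof (exp_ineq1_le a). pose proof (exp_ineq1_le (- a)). lra. }
  nra.
Qed.

(** Both sides are the squared modulus of cos((phi + i a) / 2). *)
Lemma trans_pq phi a :
  trans_p phi a * trans_p phi a + trans_q phi a * trans_q phi a = (cosh a + cos phi) / 2.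
Proof.
  unfold trans_p, trans_q.
  assert (E : cos phi = cos (phi / 2) * cos (phi / 2) - sin (phi / 2) * sin (phi / 2)).
  { rewrite <- cos_2a. f_equal. field. }
  assert (F : sin (phi / 2) * sin (phi / 2) = 1 - cos (phi / 2) * cos (phi / 2)).
  { pose proof (sin2_cos2 (phi / 2)) as S. unfold Rsqr in S. lra. }
  assert (E1 : exp a = exp (a / 2) * exp (a / 2)) by (rewrite <- exp_plus; f_equal; field).
  assert (E2 : exp (- a) = exp (- (a / 2)) * exp (- (a / 2))) by (rewrite <- exp_plus; f_equal; field).
  assert (E3 : exp (a / 2) * exp (- (a / 2)) = 1) by (rewrite <- exp_plus, <- exp_0; f_equal; ring).
  rewrite E. unfold cosh, sinh. rewrite E1, E2.
  set (u := exp (a / 2)) in *. set (w := exp (- (a / 2))) in *.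
  set (c := cos (phi / 2)) in *. set (s := sin (phi / 2)) in *.
  replace (s * ((u - w) / 2) * (s * ((u - w) / 2))) with (s * s * ((u - w) * (u - w) / 4)) by field.
  rewrite F.
  replace ((u - w) * (u - w)) with (u * u + w * w - 2 * (u * w)) by ring.
  replace (c * ((u + w) / 2) * (c * ((u + w) / 2))) with (c * c * (u * u + w * w + 2 * (u * w)) / 4) by field.
  rewrite E3. field.
Qed.

(** One limit is evaluated twice. The exponential expansion gives (cosh a + cos phi) / 2 times the
    unknown integral T; concentration at x = 0 gives the value p of [trans_fun] there times the mass
    1/2. Domination supplies T beforehand. *)
Lemma kern_cos_transform phi a : Rabs phi < PI ->
  is_int0 (fun v => cos (a * v) * kern phi v)
    (cos (phi / 2) * cosh (a / 2) / (cosh a + cos phi)).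
Proof.
  intro H. assert (HP := cosh_plus_cos_pos phi a H).
  destruct (kern_integral_bound phi H) as [B [_ HB]].
  destruct (HB (fun v => cos (a * v)) 1) as [T [HT _]].
  { intro v. apply (ex_derive_continuous (K := R_AbsRing) (V := R_NormedModule)). auto_derive. auto. }
  { intros v Hv. apply Rle_trans with 1; [apply Rabs_le, COS_bound | lra]. }
  assert (L := is_lim_seq_transform phi a T H HT).
  rewrite trans_pq in L.
  destruct (trans_fun_quadratic phi a) as [K [K0 HK]].
  set (p := trans_p phi a) in *.
  assert (C1 : forall x, continuous (fun x => trans_fun phi a x - p) x).
  { intro x. apply (continuous_minus (V := R_NormedModule) (trans_fun phi a));
      [apply continuous_trans_fun | apply continuous_const]. }
  assert (L' : is_lim_seq (fun n => RInt (fun x => trans_fun phi a x * fejer n x) 0 (1 / 2) / INR n)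
    (p * (1 / 2) + 0)).
  { apply (is_lim_seq_ext (fun n => p * (RInt (fejer n) 0 (1 / 2) / INR n)
       + RInt (fun x => (trans_fun phi a x - p) * fejer n x) 0 (1 / 2) / INR n)).
    - intro n.
      rewrite (RInt_ext (fun x => trans_fun phi a x * fejer n x) (fun x =>
        plus (scal p (fejer n x)) ((trans_fun phi a x - p) * fejer n x))).
      2:{ intros x _. unfold plus, scal; simpl; unfold mult; simpl.
          match goal with |- ?u = ?w => change (@eq R u w) end. ring. }
      assert (X1 : ex_RInt (fejer n) 0 (1 / 2)) by (apply ex_RInt_everywhere, continuous_fejer).
      rewrite (RInt_plus (V := R_CompleteNormedModule)), (RInt_scal (V := R_CompleteNormedModule)).
      + unfold plus, scal; simpl; unfold mult; simpl. unfold Rdiv. ring.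
      + exact X1.
      + apply (ex_RInt_scal (V := R_NormedModule)), X1.
      + apply ex_RInt_everywhere. intro x.
        apply continuous_Rmult; [apply C1 | apply continuous_fejer].
    - apply is_lim_seq_plus'.
      + apply (is_lim_seq_scal_l _ p (1 / 2)), fejer_mass.
      + apply is_lim_seq_abs_0.
        apply (is_lim_seq_le_le (fun _ => 0) _ (fun n => 2 * K * / INR n)).
        * intro n. split; [apply Rabs_pos |]. unfold Rdiv. rewrite Rabs_mult.
          assert (I : 0 <= / INR n).
          { destruct n as [| n]; [simpl; rewrite Rinv_0; lra |].
            left. apply Rinv_0_lt_compat, lt_0_INR. lia. }
          rewrite (Rabs_pos_eq (/ INR n)) by exact I.
          apply Rmult_le_compat_r; [exact I |].
          apply fejer_small; [exact K0 | exact C1 | exact HK].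
        * apply is_lim_seq_const.
        * replace (Finite 0) with (Rbar_mult (2 * K) 0) by (simpl; f_equal; ring).
          apply is_lim_seq_scal_l, is_lim_seq_INR_inv. }
  apply is_lim_seq_unique in L. apply is_lim_seq_unique in L'.
  rewrite L in L'. injection L' as E.
  replace (cos (phi / 2) * cosh (a / 2) / (cosh a + cos phi)) with T; [exact HT |].
  unfold p, trans_p in E. apply Rmult_eq_reg_r with (cosh a + cos phi); [| lra].
  field_simplify; [| lra]. lra.
Qed.

(** * The zeta function on the critical line *)

Definition crit (v : R) : C := (RtoC (1 / 2) + Ci * RtoC v)%C.

Lemma crit_eq v : crit v = (1 / 2, v).
Proof. unfold crit. apply C_ext; simpl; ring. Qed.

Lemma crit_neq_1 v : crit v <> 1%C.
Proof. rewrite crit_eq. intro E. injection E. lra. Qed.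

Lemma Cmod_crit v : 0 <= v -> Cmod (crit v) <= 1 + v.
Proof.
  intro Hv. eapply Rle_trans; [apply Cmod_le_Re_Im |]. rewrite crit_eq. simpl.
  rewrite !Rabs_pos_eq by lra. lra.
Qed.

Definition zeta_wave (r v : R) : R := Re (cpow r (Ci * RtoC v) * zeta (crit v))%C.

Lemma Cmod_cpow_Ci r v : Cmod (cpow r (Ci * RtoC v)) = 1.
Proof.
  rewrite Cmod_cpow. unfold Rpower.
  replace (Re (Ci * RtoC v)%C) with 0 by (unfold Re; simpl; ring).
  rewrite Rmult_0_l. apply exp_0.
Qed.

Lemma continuous_zeta_wave r v : continuous (zeta_wave r) v.
Proof.
  assert (Z : continuous (T := AbsRing_UniformSpace C_AbsRing) (U := C_NormedModule) zeta (crit v)).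
  { apply (ex_derive_continuous (K := C_AbsRing) (V := C_NormedModule)).
    apply zeta_holomorphic; [rewrite crit_eq; simpl; lra | apply crit_neq_1]. }
  assert (Cr : continuous (U := AbsRing_UniformSpace C_AbsRing) crit v).
  { apply filterlim_locally. intro eps. exists eps. intros y Hy.
    change (Cmod (crit y - crit v)%C < eps). change (Rabs (y - v) < eps) in Hy.
    replace (crit y - crit v)%C with (Ci * RtoC (y - v))%C
      by (unfold crit; rewrite RtoC_minus; ring).
    rewrite Cmod_mult, Cmod_R.
    replace (Cmod Ci) with 1; [lra |].
    unfold Cmod; simpl. rewrite <- sqrt_1 at 1. f_equal. ring. }
  assert (Zc : continuous (U := C_NormedModule) (fun v => zeta (crit v)) v)
    by exact (filterlim_comp _ _ _ crit zeta _ _ _ Cr Z).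
  assert (Z1 : continuous (fun v => Re (zeta (crit v))) v).
  { apply filterlim_locally. intro eps.
    generalize (proj1 (filterlim_locally _ _) Zc eps). apply filter_imp. intros y [Hy _]. exact Hy. }
  assert (Z2 : continuous (fun v => Im (zeta (crit v))) v).
  { apply filterlim_locally. intro eps.
    generalize (proj1 (filterlim_locally _ _) Zc eps). apply filter_imp. intros y [_ Hy]. exact Hy. }
  apply (continuous_ext (fun v => cos (v * ln r) * Re (zeta (crit v)) - sin (v * ln r) * Im (zeta (crit v)))).
  { intro t. unfold zeta_wave, cpow, Cexp. simpl.
    replace ((0 * t - 1 * 0) * ln r - (0 * 0 + 1 * t) * 0) with 0 by ring.
    replace ((0 * t - 1 * 0) * 0 + (0 * 0 + 1 * t) * ln r) with (t * ln r) by ring.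
    rewrite exp_0, !Rmult_1_l. reflexivity. }
  apply (continuous_minus (V := R_NormedModule)); apply continuous_Rmult; try assumption;
    apply (ex_derive_continuous (K := R_AbsRing) (V := R_NormedModule)); auto_derive; auto.
Qed.

Lemma zeta_term_bound s n : 0 < Re s -> s <> 1%C ->
  Cmod (zeta_term s n) <= 4 * Cmod s * Rpower (INR (S n)) (- 1 - Re s).
Proof.
  intros Hr Hs. rewrite zeta_term_cprim, (S_INR (S n)).
  apply (taylor_step (fun t => cpow t (- s)) (fun t => cprim t s) (fun t => - s * cpow t (- s - 1))%C).
  - rewrite S_INR. pose proof (pos_INR n). lra.
  - exact Hr.
  - intros t Ht. apply is_Rderive_cprim; [lra | exact Hs].
  - intros t Ht. apply is_Rderive_cpow. lra.
  - intros t Ht. rewrite Cmod_mult, Cmod_opp, Cmod_cpow. right. f_equal. f_equal.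
    unfold Re; simpl; ring.
Qed.

(* Real parts of r^(iv) x^(-s) and of r^(iv) x^(1-s) / (1-s) at s = 1/2 + iv; the former
   is the x-derivative of the latter. *)
Definition dirichlet_wave (r x v : R) : R := exp (- (ln x / 2)) * cos (v * (ln r - ln x)).

Definition prim_wave (r x v : R) : R :=
  exp (ln x / 2) * ((cos (v * (ln r - ln x)) / 2 - v * sin (v * (ln r - ln x))) / (/ 4 + v * v)).

Lemma dirichlet_wave_eq r x v :
  Re (cpow r (Ci * RtoC v) * cpow x (- crit v))%C = dirichlet_wave r x v.
Proof.
  rewrite crit_eq. unfold dirichlet_wave, cpow. rewrite <- Cexp_plus. unfold Cexp. simpl.
  f_equal; f_equal; ring || field.
Qed.

Lemma prim_wave_eq r x v :
  Re (cpow r (Ci * RtoC v) * cprim x (crit v))%C = prim_wave r x v.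
Proof.
  assert (D : 0 < / 4 + v * v) by nra.
  unfold cprim, Cdiv. rewrite Cmult_assoc, crit_eq.
  unfold cpow. rewrite <- Cexp_plus.
  replace (Ci * RtoC v * RtoC (ln r) + (1 - ((1 / 2)%R, v)) * RtoC (ln x))%C
    with (ln x / 2, v * (ln r - ln x)) by (apply C_ext; simpl; field).
  replace (/ (1 - ((1 / 2)%R, v)))%C with ((1 / 2) / (/ 4 + v * v), v / (/ 4 + v * v))%R.
  - unfold Cexp, prim_wave; simpl. field. lra.
  - apply C_ext; simpl; field; nra.
Qed.

(** The primitives telescope to their values at N + 2 and at 1, and the value at 1 is minus the pole
    term 1 / (s - 1). The indices 0..N stand for m = 1..N + 1, so the primitive is taken one step
    beyond the last summand. *)
Lemma sum_zeta_term_wave r v N :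
  sum_f_R0 (fun n => Re (cpow r (Ci * RtoC v) * zeta_term (crit v) n)%C) N
  = sum_f_R0 (fun n => dirichlet_wave r (INR (S n)) v) N
    - prim_wave r (INR (S (S N))) v - Re (cpow r (Ci * RtoC v) * (1 / (crit v - 1)))%C.
Proof.
  assert (St : forall n, Re (cpow r (Ci * RtoC v) * zeta_term (crit v) n)%C =
    dirichlet_wave r (INR (S n)) v - (prim_wave r (INR (S (S n))) v - prim_wave r (INR (S n)) v)).
  { intro n. rewrite zeta_term_cprim, <- dirichlet_wave_eq, <- !prim_wave_eq.
    unfold Re; simpl. ring. }
  induction N as [| N IH].
  - cbn [sum_f_R0]. rewrite St.
    replace (Re (cpow r (Ci * RtoC v) * (1 / (crit v - 1)))%C) with (- prim_wave r (INR 1) v); [ring |].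
    rewrite <- prim_wave_eq.
    replace (cprim (INR 1) (crit v)) with (- (1 / (crit v - 1)))%C.
    + unfold Re; simpl; ring.
    + unfold cprim. change (INR 1) with 1. unfold cpow. rewrite ln_1.
      replace ((1 - crit v) * 0)%C with (RtoC 0) by ring. rewrite Cexp_0.
      field. split; apply Cminus_neq_0; [apply crit_neq_1 |].
      intro E. apply (crit_neq_1 v). symmetry. exact E.
  - rewrite !tech5, IH, St. ring.
Qed.

(** The tail from index N + 1 of the bound in [zeta_term_bound] at Re s = 1/2, with the factor |s|
    divided out so that it does not depend on v. *)
Definition zeta_tail (N : nat) : R :=
  Series (fun n => 4 * Rpower (INR (S (S N + n))) (- 1 - 1 / 2)).

Lemma ex_series_zeta_tail N : ex_series (fun n => 4 * Rpower (INR (S (N + n))) (- 1 - 1 / 2)).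
Proof.
  apply (ex_series_incr_n (fun n => 4 * Rpower (INR (S n)) (- 1 - 1 / 2)) N).
  apply (ex_series_scal (K := R_AbsRing) (V := R_NormedModule) 4), ex_series_Rpower. lra.
Qed.

Lemma is_lim_seq_zeta_tail : is_lim_seq zeta_tail 0.
Proof.
  pose (b := fun n => 4 * Rpower (INR (S n)) (- 1 - 1 / 2)).
  assert (E : ex_series b) by exact (ex_series_zeta_tail 0).
  apply (is_lim_seq_ext (fun N => Series b - sum_f_R0 b N)).
  - intro N. rewrite (Series_incr_n b (S N)) by (lia || exact E). simpl pred.
    unfold zeta_tail, b. ring.
  - replace (Finite 0) with (Finite (Series b - Series b)) by (f_equal; ring).
    apply is_lim_seq_minus'; [apply is_lim_seq_const |].
    eapply is_lim_seq_ext; [| exact (Series_correct _ E)].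
    intro n. apply sum_n_Reals.
Qed.

(** The pole term left by [sum_zeta_term_wave] cancels the 1 / (s - 1) in the definition of [zeta],
    so the difference is exactly a tail of the series. *)
Lemma zeta_wave_approx r v N :
  Rabs (zeta_wave r v - (sum_f_R0 (fun n => dirichlet_wave r (INR (S n)) v) N
                         - prim_wave r (INR (S (S N))) v)) <= Cmod (crit v) * zeta_tail N.
Proof.
  assert (Hr : Re (crit v) = 1 / 2) by (rewrite crit_eq; reflexivity).
  assert (Hs := crit_neq_1 v).
  pose (a := fun n => Re (cpow r (Ci * RtoC v) * zeta_term (crit v) n)%C).
  pose (b := fun n => 4 * Rpower (INR (S n)) (- 1 - 1 / 2)).
  assert (A : is_series a (Re (cpow r (Ci * RtoC v) * CSeries (zeta_term (crit v)))%C)).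
  { apply (is_Cseries_scal _ (zeta_term (crit v))). apply is_Cseries_zeta_term; [lra | exact Hs]. }
  assert (B : forall n, Rabs (a n) <= Cmod (crit v) * b n).
  { intro n. unfold a. eapply Rle_trans; [apply Re_le_Cmod |].
    rewrite Cmod_mult, Cmod_cpow_Ci, Rmult_1_l.
    eapply Rle_trans; [apply zeta_term_bound; [lra | exact Hs] |].
    rewrite Hr. unfold b. right; ring. }
  destruct (real_series_bound (fun n => a (S N + n)%nat) (fun n => Cmod (crit v) * b (S N + n)%nat))
    as [T1 T2].
  - apply (ex_series_scal (K := R_AbsRing) (V := R_NormedModule) (Cmod (crit v))).
    apply (ex_series_zeta_tail (S N)).
  - intro n. apply B.
  - rewrite Series_scal_l in T2.
    replace (zeta_wave r v - _) with (Series (fun n => a (S N + n)%nat)); [exact T2 |].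
    assert (Q := Series_incr_n a (S N) ltac:(lia) (ex_intro _ _ A)).
    rewrite (is_series_unique _ _ A) in Q. simpl pred in Q.
    unfold a in Q at 1. rewrite sum_zeta_term_wave in Q.
    unfold zeta_wave, zeta.
    replace (Re (cpow r (Ci * RtoC v) * (1 / (crit v - 1) + CSeries (zeta_term (crit v))))%C)
      with (Re (cpow r (Ci * RtoC v) * (1 / (crit v - 1)))%C
            + Re (cpow r (Ci * RtoC v) * CSeries (zeta_term (crit v)))%C)
      by (unfold Re; simpl; ring).
    lra.
Qed.

(** By Cauchy-Schwarz the numerator is at most the square root of 1/4 + v^2, and that root is at
    least 1/2. *)
Lemma prim_wave_bound r x v : Rabs (prim_wave r x v) <= 2 * exp (ln x / 2).
Proof.
  unfold prim_wave.
  set (c := cos _). set (s := sin _).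
  assert (H : c * c + s * s = 1).
  { pose proof (sin2_cos2 (v * (ln r - ln x))) as S. unfold Rsqr in S. unfold c, s. lra. }
  clearbody c s.
  assert (D : 0 < / 4 + v * v) by nra.
  rewrite Rabs_mult, (Rabs_pos_eq (exp _)), Rmult_comm by (left; apply exp_pos).
  apply Rmult_le_compat_r; [left; apply exp_pos |].
  unfold Rdiv at 1. rewrite Rabs_mult, (Rabs_pos_eq (/ _)) by (left; apply Rinv_0_lt_compat, D).
  apply Rle_div_l; [exact D |].
  apply Rabs_le.
  assert (T : (c / 2 - v * s) * (c / 2 - v * s) <= / 4 + v * v).
  { assert (Q : 0 <= (c * v + s / 2) * (c * v + s / 2)) by apply Rle_0_sqr.
    assert (E : (c / 2 - v * s) * (c / 2 - v * s) + (c * v + s / 2) * (c * v + s / 2)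
                = (/ 4 + v * v) * (c * c + s * s)) by field.
    rewrite H in E. lra. }
  split; nra.
Qed.

Lemma dirichlet_wave_bound r x v : Rabs (dirichlet_wave r x v) <= exp (- (ln x / 2)).
Proof.
  unfold dirichlet_wave. rewrite Rabs_mult, (Rabs_pos_eq (exp _)) by (left; apply exp_pos).
  assert (Rabs (cos (v * (ln r - ln x))) <= 1) by (apply Rabs_le, COS_bound).
  pose proof (exp_pos (- (ln x / 2))). nra.
Qed.

(** The approximation with N = 0 already gives linear growth. *)
Lemma zeta_wave_linear r : exists A, forall v, 0 <= v -> Rabs (zeta_wave r v) <= A * (1 + v).
Proof.
  exists (exp (- (ln (INR 1) / 2)) + 2 * exp (ln (INR 2) / 2) + Rabs (zeta_tail 0)).
  intros v Hv.
  pose proof (zeta_wave_approx r v 0) as A. cbn [sum_f_R0] in A.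
  pose proof (dirichlet_wave_bound r (INR 1) v) as B1.
  pose proof (prim_wave_bound r (INR 2) v) as B2.
  pose proof (Cmod_crit v Hv) as C1. pose proof (Cmod_ge_0 (crit v)) as C0.
  pose proof (Rle_abs (zeta_tail 0)) as T. pose proof (Rabs_pos (zeta_tail 0)) as T0.
  assert (X : Cmod (crit v) * zeta_tail 0 <= (1 + v) * Rabs (zeta_tail 0)) by nra.
  set (Z := zeta_wave r v) in *. set (d := dirichlet_wave r (INR 1) v) in *.
  set (u := prim_wave r (INR 2) v) in *.
  assert (Rabs Z <= Rabs (Z - (d - u)) + Rabs d + Rabs u).
  { replace Z with ((Z - (d - u)) + d + - u) at 1 by ring.
    eapply Rle_trans; [apply Rabs_triang |]. rewrite Rabs_Ropp.
    apply Rplus_le_compat_r, Rabs_triang. }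
  assert (0 < exp (- (ln (INR 1) / 2))) by apply exp_pos.
  assert (0 < exp (ln (INR 2) / 2)) by apply exp_pos.
  nra.
Qed.

Lemma damped_integrand_eq r phi v : damped_integrand r phi v = zeta_wave r v * kern phi v.
Proof. reflexivity. Qed.

Lemma ex_damped_integral r phi : Rabs phi < PI ->
  ex_RInt_gen (damped_integrand r phi) (at_point 0) (Rbar_locally p_infty).
Proof.
  intro H. destruct (kern_integral_bound phi H) as [B [_ HB]].
  destruct (zeta_wave_linear r) as [A HA].
  destruct (HB (zeta_wave r) A (continuous_zeta_wave r) HA) as [l [Hl _]].
  exists l. exact Hl.
Qed.

(** * The transform of the integral term *)

Lemma real_MVI_between (f f' : R -> R) a b M :
  (forall t, Rmin a b <= t <= Rmax a b -> is_derive f t (f' t)) ->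
  (forall t, Rmin a b <= t <= Rmax a b -> Rabs (f' t) <= M) ->
  Rabs (f b - f a) <= M * Rabs (b - a).
Proof.
  intros D B. destruct (Rle_dec a b) as [H | H].
  - rewrite Rmin_left, Rmax_right in * by exact H.
    rewrite (Rabs_pos_eq (b - a)) by lra. apply (real_MVI f f'); assumption.
  - rewrite Rmin_right, Rmax_left in * by lra.
    rewrite Rabs_minus_sym, (Rabs_minus_sym b), (Rabs_pos_eq (a - b)) by lra.
    apply (real_MVI f f'); [lra | assumption | assumption].
Qed.

Lemma Rabs_sub_between a b t : Rmin a b <= t <= Rmax a b -> Rabs (t - a) <= Rabs (b - a).
Proof.
  intro H. unfold Rmin, Rmax in H. destruct (Rle_dec a b).
  - rewrite !Rabs_pos_eq by lra. lra.
  - rewrite !Rabs_left1 by lra. lra.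
Qed.

Lemma taylor_quadratic (f f' f'' : R -> R) a b M :
  (forall t, Rmin a b <= t <= Rmax a b -> is_derive f t (f' t)) ->
  (forall t, Rmin a b <= t <= Rmax a b -> is_derive f' t (f'' t)) ->
  (forall t, Rmin a b <= t <= Rmax a b -> Rabs (f'' t) <= M) ->
  Rabs (f b - f a - (b - a) * f' a) <= M * ((b - a) * (b - a)).
Proof.
  intros D1 D2 B.
  assert (M0 : 0 <= M).
  { eapply Rle_trans; [apply Rabs_pos | apply (B a)]. split; [apply Rmin_l | apply Rmax_l]. }
  replace (f b - f a - (b - a) * f' a) with ((f b - b * f' a) - (f a - a * f' a)) by ring.
  replace (M * ((b - a) * (b - a))) with (M * Rabs (b - a) * Rabs (b - a)).
  2:{ rewrite Rmult_assoc, <- Rabs_mult, Rabs_pos_eq by apply Rle_0_sqr. reflexivity. }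
  apply (real_MVI_between (fun t => f t - t * f' a) (fun t => f' t - f' a)).
  - intros t Ht. apply (is_derive_minus f (fun t => t * f' a)); [apply D1, Ht |].
    auto_derive; [auto | ring].
  - intros t Ht.
    apply Rle_trans with (M * Rabs (t - a)).
    + assert (I : forall u, Rmin a t <= u <= Rmax a t -> Rmin a b <= u <= Rmax a b).
      { intros u Hu. unfold Rmin, Rmax in *.
        destruct (Rle_dec a t), (Rle_dec a b); lra. }
      apply (real_MVI_between f' f''); auto.
    + apply Rmult_le_compat_l; [exact M0 | apply Rabs_sub_between, Ht].
Qed.

Lemma is_derive_quadratic (f : R -> R) x l d K : 0 < d ->
  (forall h, Rabs h <= d -> Rabs (f (x + h) - f x - h * l) <= K * (h * h)) ->
  is_derive f x l.
Proof.
  intros Hd H. apply is_derive_Reals. intros eps Heps.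
  assert (K1 : 0 < Rabs K + 1) by (pose proof (Rabs_pos K); lra).
  assert (P : 0 < Rmin d (eps / (Rabs K + 1))).
  { apply Rmin_pos; [exact Hd |]. apply Rdiv_lt_0_compat; lra. }
  exists (mkposreal _ P). simpl. intros h Hh0 Hh.
  assert (D1 := Rmin_l d (eps / (Rabs K + 1))). assert (D2 := Rmin_r d (eps / (Rabs K + 1))).
  specialize (H h ltac:(lra)). assert (Hh' := Rabs_pos_lt h Hh0).
  replace ((f (x + h) - f x) / h - l) with ((f (x + h) - f x - h * l) / h) by (field; exact Hh0).
  unfold Rdiv. rewrite Rabs_mult, Rabs_inv. apply Rlt_div_l; [exact Hh' |].
  eapply Rle_lt_trans; [exact H |].
  assert (S : h * h = Rabs h * Rabs h) by (rewrite <- Rabs_mult, Rabs_pos_eq by nra; reflexivity).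
  rewrite S.
  assert (L : Rabs h * (Rabs K + 1) < eps) by (apply Rlt_div_r; lra).
  pose proof (Rle_abs K). nra.
Qed.

Lemma is_derive_prim_wave r v x : 0 < x ->
  is_derive (fun x => prim_wave r x v) x (dirichlet_wave r x v).
Proof.
  intro Hx. assert (D : 0 < / 4 + v * v) by nra.
  unfold prim_wave, dirichlet_wave. auto_derive; [lra |].
  replace (exp (- (ln x / 2))) with (exp (ln x / 2) * / x).
  - unfold Rminus, Rdiv. field. split; nra.
  - rewrite <- (exp_ln x) at 2 by exact Hx. rewrite <- exp_Ropp, <- exp_plus. f_equal. field.
Qed.

Lemma is_derive_dirichlet_wave r v x : 0 < x ->
  is_derive (fun x => dirichlet_wave r x v) x
    (exp (- (ln x / 2)) / x * (v * sin (v * (ln r - ln x)) - cos (v * (ln r - ln x)) / 2)).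
Proof.
  intro Hx. unfold dirichlet_wave. auto_derive; [lra |]. unfold Rminus, Rdiv. field. lra.
Qed.

Lemma continuous_prim_wave r x v : continuous (prim_wave r x) v.
Proof.
  apply (ex_derive_continuous (K := R_AbsRing) (V := R_NormedModule)).
  unfold prim_wave. auto_derive. nra.
Qed.

Lemma continuous_dirichlet_wave r x v : continuous (dirichlet_wave r x) v.
Proof.
  apply (ex_derive_continuous (K := R_AbsRing) (V := R_NormedModule)).
  unfold dirichlet_wave. auto_derive. auto.
Qed.

(** A remainder of order h^2, linear in v, can be integrated against the kernel; this replaces a
    theorem on differentiation under the integral sign. The condition on h keeps the segment in [x /
    2, oo), away from the singularity at 0. *)
Lemma prim_wave_taylor r x h v : 0 < x -> Rabs h <= x / 2 -> 0 <= v ->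
  Rabs (prim_wave r (x + h) v - prim_wave r x v - h * dirichlet_wave r x v)
    <= exp (- (ln (x / 2) / 2)) / (x / 2) * (h * h) * (1 + v).
Proof.
  intros Hx Hh Hv. apply Rabs_le_between in Hh.
  replace (exp (- (ln (x / 2) / 2)) / (x / 2) * (h * h) * (1 + v)) with
    (exp (- (ln (x / 2) / 2)) / (x / 2) * (1 + v) * ((x + h - x) * (x + h - x))) by ring.
  replace (h * dirichlet_wave r x v) with ((x + h - x) * dirichlet_wave r x v) by ring.
  assert (I : forall t, Rmin x (x + h) <= t <= Rmax x (x + h) -> x / 2 <= t).
  { intros t Ht. unfold Rmin, Rmax in Ht. destruct (Rle_dec x (x + h)); lra. }
  apply (taylor_quadratic (fun x => prim_wave r x v) (fun x => dirichlet_wave r x v)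
    (fun x => exp (- (ln x / 2)) / x * (v * sin (v * (ln r - ln x)) - cos (v * (ln r - ln x)) / 2))).
  - intros t Ht. apply is_derive_prim_wave. specialize (I t Ht). lra.
  - intros t Ht. apply is_derive_dirichlet_wave. specialize (I t Ht). lra.
  - intros t Ht. specialize (I t Ht).
    assert (E0 := exp_pos (- (ln t / 2))). assert (V0 : 0 < / t) by (apply Rinv_0_lt_compat; lra).
    rewrite Rabs_mult, (Rabs_pos_eq (exp _ / t)) by (apply Rlt_le, Rmult_lt_0_compat; assumption).
    apply Rmult_le_compat.
    + apply Rlt_le, Rmult_lt_0_compat; assumption.
    + apply Rabs_pos.
    + apply Rmult_le_compat; [lra | lra | | apply Rinv_le_contravar; lra].
      apply exp_le_mono. assert (ln (x / 2) <= ln t) by (apply ln_le; lra). lra.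
    + pose proof (SIN_bound (v * (ln r - ln t))). pose proof (COS_bound (v * (ln r - ln t))).
      apply Rabs_le. split; nra.
Qed.

Definition prim_transform (r phi x : R) : R :=
  RInt_gen (fun v => prim_wave r x v * kern phi v) (at_point 0) (Rbar_locally p_infty).

Lemma prim_transform_correct r phi x : Rabs phi < PI ->
  is_int0 (fun v => prim_wave r x v * kern phi v) (prim_transform r phi x).
Proof.
  intro H. destruct (kern_integral_bound phi H) as [B [_ HB]].
  apply (RInt_gen_correct (V := R_CompleteNormedModule)).
  destruct (HB (prim_wave r x) (2 * exp (ln x / 2)) (continuous_prim_wave r x)) as [l [Hl _]].
  - intros v Hv. eapply Rle_trans; [apply prim_wave_bound |].
    pose proof (exp_pos (ln x / 2)). nra.
  - exists l. exact Hl.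
Qed.

(** Take a = ln(r / x) in the cosine transform: cosh(a / 2) = (x + r) / (2 sqrt(r x)), and cosh a +
    cos phi is the quadratic denominator divided by 2 r x. *)
Lemma dirichlet_wave_transform r phi x : Rabs phi < PI -> 0 < r -> 0 < x ->
  is_int0 (fun v => dirichlet_wave r x v * kern phi v)
    (exp (ln r / 2) * (cos (phi / 2) * ((x + r) / (x * x + 2 * (r * x) * cos phi + r * r)))).
Proof.
  intros H Hr Hx.
  (* The second integral enters with coefficient 0, so the linear combination acts as a scaling
     rule. *)
  pose proof (is_int0_lincomb _ _ (exp (- (ln x / 2))) 0 _ _
    (kern_cos_transform phi (ln r - ln x) H) (kern_cos_transform phi 0 H)) as L.
  assert (P := cosh_plus_cos_pos phi (ln r - ln x) H).
  evar_last.
  - eapply is_int0_ext; [| exact L]. intro v. cbv beta. unfold dirichlet_wave.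
    rewrite (Rmult_comm (ln r - ln x) v). ring.
  - cbv beta. rewrite Rmult_0_l, Rplus_0_r.
    unfold cosh in *.
    replace (- (ln r - ln x)) with (ln x + - ln r) in * by ring.
    replace (ln r - ln x) with (ln r + - ln x) in * by ring.
    replace ((ln r + - ln x) / 2) with (ln r / 2 + - (ln x / 2)) by field.
    replace (- (ln r / 2 + - (ln x / 2))) with (ln x / 2 + - (ln r / 2)) by ring.
    rewrite !exp_plus, !exp_Ropp in *. rewrite !exp_ln in * by assumption.
    assert (R2 : r = exp (ln r / 2) * exp (ln r / 2))
      by (rewrite <- exp_plus; rewrite <- (exp_ln r) at 1 by exact Hr; f_equal; field).
    assert (X2 : x = exp (ln x / 2) * exp (ln x / 2))
      by (rewrite <- exp_plus; rewrite <- (exp_ln x) at 1 by exact Hx; f_equal; field).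
    pose proof (exp_pos (ln r / 2)). pose proof (exp_pos (ln x / 2)).
    set (p := exp (ln r / 2)) in *. set (q := exp (ln x / 2)) in *. clearbody p q.
    set (c := cos phi) in *. clearbody c.
    assert (Q : 0 < x * x + 2 * (r * x) * c + r * r).
    { replace (x * x + 2 * (r * x) * c + r * r)
        with (2 * (r * x) * ((r * / x + x * / r) / 2 + c)) by (field; lra).
      apply Rmult_lt_0_compat; [nra | exact P]. }
    subst r x. unfold minus. field. repeat split; nra.
Qed.

Lemma is_derive_prim_transform r phi x : Rabs phi < PI -> 0 < r -> 0 < x ->
  is_derive (prim_transform r phi) x
    (exp (ln r / 2) * (cos (phi / 2) * ((x + r) / (x * x + 2 * (r * x) * cos phi + r * r)))).
Proof.
  intros H Hr Hx. destruct (kern_integral_bound phi H) as [B [B0 HB]].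
  pose (K := exp (- (ln (x / 2) / 2)) / (x / 2)).
  apply (is_derive_quadratic _ _ _ (x / 2) (K * B)); [lra |].
  intros h Hh.
  (* The redundant factors 1 give the integrand the shape that two applications of [is_int0_lincomb]
     produce. *)
  destruct (HB (fun v => 1 * (1 * prim_wave r (x + h) v + - (1) * prim_wave r x v)
                        + - h * dirichlet_wave r x v) (K * (h * h))) as [l [L1 L2]].
  - intro v. apply (ex_derive_continuous (K := R_AbsRing) (V := R_NormedModule)).
    unfold prim_wave, dirichlet_wave. auto_derive. repeat split; nra.
  - intros v Hv. eapply Rle_trans; [| apply (prim_wave_taylor r x h v Hx Hh Hv)].
    right. f_equal. ring.
  - pose proof (is_int0_lincomb _ _ 1 (- h) _ _
      (is_int0_lincomb _ _ 1 (- (1)) _ _ (prim_transform_correct r phi (x + h) H)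
         (prim_transform_correct r phi x H)) (dirichlet_wave_transform r phi x H Hr Hx)) as L3.
    cbv beta in L3. eapply is_int0_ext in L3.
    + rewrite (is_int0_unique _ _ _ L1 L3) in L2.
      eapply Rle_trans; [| eapply Rle_trans; [exact L2 |]]; right; [f_equal |]; ring.
    + intro v. cbv beta. ring.
Qed.

(** Found by completing the square, (x + r cos phi)^2 + (r sin phi)^2, and splitting the numerator
    as (x + r cos phi) + r (1 - cos phi). *)
Definition prim_closed (r phi x : R) : R :=
  exp (ln r / 2) * (cos (phi / 2) * (ln (x * x + 2 * (r * x) * cos phi + r * r) / 2)
    + sin (phi / 2) * atan ((x + r * cos phi) / (r * sin phi))).

Lemma quadratic_pos r phi x : 0 < phi < PI -> 0 < r ->
  0 < x * x + 2 * (r * x) * cos phi + r * r.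
Proof.
  intros H Hr. assert (S : 0 < sin phi) by (apply sin_gt_0; lra).
  assert (E := sin2_cos2 phi). unfold Rsqr in E.
  replace (x * x + 2 * (r * x) * cos phi + r * r) with
    ((x + r * cos phi) * (x + r * cos phi) + r * r * (sin phi * sin phi)).
  - assert (0 < r * r * (sin phi * sin phi)) by (apply Rmult_lt_0_compat; nra).
    pose proof (Rle_0_sqr (x + r * cos phi)) as Q. unfold Rsqr in Q. lra.
  - replace (sin phi * sin phi) with (1 - cos phi * cos phi) by lra. ring.
Qed.

Lemma is_derive_prim_closed r phi x : 0 < phi < PI -> 0 < r ->
  is_derive (prim_closed r phi) x
    (exp (ln r / 2) * (cos (phi / 2) * ((x + r) / (x * x + 2 * (r * x) * cos phi + r * r)))).
Proof.
  intros H Hr. assert (Q := quadratic_pos r phi x H Hr).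
  assert (S : 0 < sin phi) by (apply sin_gt_0; lra).
  assert (RS : 0 < r * sin phi) by nra.
  assert (E := sin2_cos2 (phi / 2)). unfold Rsqr in E.
  assert (E1 : sin phi = 2 * sin (phi / 2) * cos (phi / 2)).
  { rewrite <- sin_2a. f_equal. field. }
  assert (E2 : cos phi = 1 - 2 * (sin (phi / 2) * sin (phi / 2))).
  { replace phi with (2 * (phi / 2)) at 1 by field. rewrite cos_2a_sin. ring. }
  assert (E0 := sin2_cos2 phi). unfold Rsqr in E0.
  assert (Den : forall y, (r * sin phi) * (r * sin phi) + (y + r * cos phi) * (y + r * cos phi)
                = y * y + 2 * (r * y) * cos phi + r * r).
  { intro y. replace (r * sin phi * (r * sin phi)) with (r * r * (1 - cos phi * cos phi)) by (rewrite <- E0; ring). ring. }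
  unfold prim_closed.
  evar_last.
  { apply (is_derive_scal (fun x => (cos (phi / 2) * (ln (x * x + 2 * (r * x) * cos phi + r * r) / 2)
      + sin (phi / 2) * atan ((x + r * cos phi) / (r * sin phi))))).
    apply (is_derive_plus (fun x => cos (phi / 2) * (ln (x * x + 2 * (r * x) * cos phi + r * r) / 2))
      (fun x => sin (phi / 2) * atan ((x + r * cos phi) / (r * sin phi)))).
    - instantiate (1 := cos (phi / 2) * ((x + r * cos phi) / (x * x + 2 * (r * x) * cos phi + r * r))).
      auto_derive; [exact Q | field; lra].
    - instantiate (1 := sin (phi / 2) * (r * sin phi / (x * x + 2 * (r * x) * cos phi + r * r))).
      auto_derive; [auto |]. rewrite <- Den. field. repeat split; try lra; rewrite ?Den; nra. }
  unfold scal, plus; simpl; unfold mult; simpl. f_equal.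
  transitivity ((cos (phi / 2) * (x + r * cos phi) + sin (phi / 2) * (r * sin phi))
    / (x * x + 2 * (r * x) * cos phi + r * r)); [field; lra |].
  replace (cos (phi / 2) * (x + r * cos phi) + sin (phi / 2) * (r * sin phi))
    with (cos (phi / 2) * (x + r)) by (rewrite E1, E2; ring).
  field. lra.
Qed.

Lemma prim_transform_bound r phi : Rabs phi < PI -> exists B, forall x,
  Rabs (prim_transform r phi x) <= B * exp (ln x / 2).
Proof.
  intro H. destruct (kern_integral_bound phi H) as [B [B0 HB]].
  exists (2 * B). intro x.
  destruct (HB (prim_wave r x) (2 * exp (ln x / 2)) (continuous_prim_wave r x)) as [l [L1 L2]].
  - intros v Hv. eapply Rle_trans; [apply prim_wave_bound |].
    pose proof (exp_pos (ln x / 2)). nra.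
  - rewrite (is_int0_unique _ _ _ (prim_transform_correct r phi x H) L1).
    eapply Rle_trans; [exact L2 | right; ring].
Qed.

(* Both sides have the same derivative in x and the left one vanishes at 0+; it is
   evaluated at d * d, where its bound is linear in d. *)
Lemma prim_transform_eq r phi x : 0 < phi < PI -> 0 < r -> 0 < x ->
  prim_transform r phi x = prim_closed r phi x - prim_closed r phi 0.
Proof.
  intros H Hr Hx.
  assert (H' : Rabs phi < PI) by (rewrite Rabs_pos_eq; lra).
  destruct (prim_transform_bound r phi H') as [B HB].
  pose (P := prim_closed r phi).
  set (k := prim_transform r phi x - (P x - P 0)).
  assert (Kb : forall d, 0 < d -> Rabs k <= B * d + Rabs (P (d * d) - P 0)).
  { intros d Hd.
    assert (D2 : 0 < d * d) by nra.
    assert (C : Rabs ((prim_transform r phi x - P x) - (prim_transform r phi (d * d) - P (d * d)))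
              <= 0 * Rabs (x - d * d)).
    { apply (real_MVI_between (fun t => prim_transform r phi t - P t) (fun _ => 0)).
      - intros t Ht.
        assert (0 < t) by (unfold Rmin in Ht; destruct (Rle_dec (d * d) x); lra).
        evar_last.
        + apply (is_derive_minus (prim_transform r phi) P);
            [apply is_derive_prim_transform | apply is_derive_prim_closed]; assumption.
        + unfold minus, plus, opp; simpl. ring.
      - intros t _. rewrite Rabs_R0. lra. }
    rewrite Rmult_0_l in C.
    specialize (HB (d * d)).
    rewrite ln_mult in HB by assumption.
    replace ((ln d + ln d) / 2) with (ln d) in HB by field.
    rewrite exp_ln in HB by exact Hd.
    replace k with (((prim_transform r phi x - P x) - (prim_transform r phi (d * d) - P (d * d)))
      + prim_transform r phi (d * d) + - (P (d * d) - P 0)) by (unfold k; ring).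
    eapply Rle_trans; [apply Rabs_triang |]. rewrite Rabs_Ropp.
    apply Rplus_le_compat_r.
    eapply Rle_trans; [apply Rabs_triang |]. lra. }
  assert (Cont : continuous (fun d => B * d + Rabs (P (d * d) - P 0)) 0).
  { apply (continuous_plus (V := R_NormedModule) (fun d => B * d)).
    - apply (ex_derive_continuous (K := R_AbsRing) (V := R_NormedModule)). auto_derive. auto.
    - apply (continuous_comp (fun d => P (d * d) - P 0) Rabs); [| apply continuous_Rabs].
      apply (continuous_minus (V := R_NormedModule) (fun d => P (d * d))); [| apply continuous_const].
      apply (continuous_comp (fun d => d * d) P).
      + apply (ex_derive_continuous (K := R_AbsRing) (V := R_NormedModule)). auto_derive. auto.
      + apply (ex_derive_continuous (K := R_AbsRing) (V := R_NormedModule)).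
        eexists. apply is_derive_prim_closed; assumption. }
  assert (K0 : k = 0).
  { destruct (Req_dec k 0) as [E | N]; [exact E | exfalso].
    assert (Pk := Rabs_pos_lt k N).
    destruct (proj1 (filterlim_locally _ _) Cont (mkposreal _ Pk)) as [d Hd].
    assert (D2 : 0 < d / 2) by (pose proof (cond_pos d); lra).
    specialize (Hd (d / 2)). specialize (Kb (d / 2) D2).
    assert (Bd : ball 0 d (d / 2)).
    { change (Rabs (d / 2 - 0) < d). rewrite Rminus_0_r, Rabs_pos_eq by lra.
      pose proof (cond_pos d); lra. }
    specialize (Hd Bd).
    match type of Hd with ball ?a _ ?b => change (Rabs (b - a) < Rabs k) in Hd end.
    rewrite Rmult_0_r, Rmult_0_l, Rminus_diag, Rabs_R0, Rplus_0_r, Rminus_0_r in Hd.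
    pose proof (Rle_abs (B * (d / 2) + Rabs (P (d / 2 * (d / 2)) - P 0))). lra. }
  unfold k in K0. fold P. lra.
Qed.

(** * The limit *)

Lemma harmonic_ln N :
  ln (INR (S (S N))) <= sum_f_R0 (fun n => / INR (S n)) N <= 1 + ln (INR (S N)).
Proof.
  assert (L : forall x, 0 < x -> / (x + 1) <= ln (x + 1) - ln x <= / x).
  { intros x Hx. assert (X : 0 < / (x + 1)) by (apply Rinv_0_lt_compat; lra). split.
    - pose proof (exp_ineq1_le (ln x - ln (x + 1))) as E. unfold Rminus in E.
      rewrite exp_plus, exp_Ropp, !exp_ln in E by lra.
      replace (x * / (x + 1)) with (1 - / (x + 1)) in E by (field; lra). lra.
    - pose proof (exp_ineq1_le (ln (x + 1) - ln x)) as E. unfold Rminus in E.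
      rewrite exp_plus, exp_Ropp, !exp_ln in E by lra.
      replace ((x + 1) * / x) with (1 + / x) in E by (field; lra). lra. }
  induction N as [| N IH].
  - cbn [sum_f_R0]. change (INR 1) with 1. rewrite ln_1, Rinv_1.
    specialize (L 1 ltac:(lra)). rewrite ln_1, Rinv_1 in L. change (INR 2) with (1 + 1). lra.
  - rewrite tech5. assert (P : 0 < INR (S N)) by (apply lt_0_INR; lia).
    assert (P2 : 0 < INR (S (S N))) by (apply lt_0_INR; lia).
    pose proof (L _ P) as L1. pose proof (L _ P2) as L2.
    rewrite <- !S_INR in L1, L2. lra.
Qed.

(** The denominator is at least (x - r)^2 for every phi, which makes the bound uniform. The constant
    7 covers 3 r + r^2 / x, at most 27/4 for r < 3/2 and x >= 1. *)
Lemma quadratic_term_bound r phi x : 0 < phi < PI -> 0 < r < 3 / 2 -> 1 <= x -> x <> r ->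
  Rabs ((x + r) / (x * x + 2 * (r * x) * cos phi + r * r) - / x) <= 7 / ((x - r) * (x - r)).
Proof.
  intros H Hr Hx Hn. assert (Q := quadratic_pos r phi x H (proj1 Hr)).
  pose proof (COS_bound phi) as C.
  assert (D : 0 < (x - r) * (x - r)) by (pose proof (Rsqr_pos_lt (x - r)); unfold Rsqr in *; lra).
  assert (DQ : (x - r) * (x - r) <= x * x + 2 * (r * x) * cos phi + r * r).
  { assert (0 <= r * x * (1 + cos phi)) by (apply Rmult_le_pos; nra). nra. }
  set (q := x * x + 2 * (r * x) * cos phi + r * r) in *.
  replace ((x + r) / q - / x) with ((r * x * (1 - 2 * cos phi) - r * r) / x / q)
    by (unfold q in *; field; lra).
  apply Rle_trans with (7 / q).
  - unfold Rdiv at 1. rewrite Rabs_mult, (Rabs_pos_eq (/ q)) by (left; apply Rinv_0_lt_compat, Q).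
    apply Rmult_le_compat_r; [left; apply Rinv_0_lt_compat, Q |].
    unfold Rdiv. rewrite Rabs_mult, (Rabs_pos_eq (/ x)) by (left; apply Rinv_0_lt_compat; lra).
    apply Rle_div_l; [lra |]. apply Rabs_le.
    assert (0 < r * x) by nra.
    assert (r * x * (-1) <= r * x * (1 - 2 * cos phi)) by (apply Rmult_le_compat_l; lra).
    assert (r * x * (1 - 2 * cos phi) <= r * x * 3) by (apply Rmult_le_compat_l; lra).
    nra.
  - unfold Rdiv. apply Rmult_le_compat_l; [lra |]. apply Rinv_le_contravar; assumption.
Qed.

(** Both the sum and the logarithm are compared with ln x at x = N + 2. In K, the first summand is
    the term m = 1, the only one that degenerates as r -> 1; 112 bounds the terms m >= 2; 1 is the
    error in [harmonic_ln]; ln 16 comes from x^2 / 16 <= q <= 16 x^2 for the quadratic q. *)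
Lemma log_sum_bound r : 1 / 2 < r < 3 / 2 -> r <> 1 -> exists K, 0 <= K /\ forall phi N, 0 < phi < PI ->
  Rabs (sum_f_R0 (fun n => (INR (S n) + r) /
          (INR (S n) * INR (S n) + 2 * (r * INR (S n)) * cos phi + r * r)) N
        - ln (INR (S (S N)) * INR (S (S N)) + 2 * (r * INR (S (S N))) * cos phi + r * r) / 2) <= K.
Proof.
  intros Hr Hn. pose (K1 := 7 / ((1 - r) * (1 - r))).
  assert (D : 0 < (1 - r) * (1 - r)) by (pose proof (Rsqr_pos_lt (1 - r)); unfold Rsqr in *; lra).
  assert (K10 : 0 < K1) by (apply Rdiv_lt_0_compat; lra).
  assert (L16 : 0 < ln 16) by (rewrite <- ln_1; apply ln_increasing; lra).
  exists (K1 + 112 + 1 + ln 16). split; [lra |]. intros phi N H.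
  pose (g := fun x => (x + r) / (x * x + 2 * (r * x) * cos phi + r * r)).
  assert (A : Rabs (sum_f_R0 (fun n => g (INR (S n)) - / INR (S n)) N) <= K1 + 112 * (1 - / INR (S N))).
  { induction N as [| N IH].
    - cbn [sum_f_R0]. change (INR 1) with 1.
      eapply Rle_trans; [apply quadratic_term_bound; lra |]. fold K1. rewrite Rinv_1. lra.
    - rewrite tech5. eapply Rle_trans; [apply Rabs_triang |].
      set (x := INR (S (S N))).
      assert (X : 2 <= x).
      { unfold x. rewrite !S_INR. pose proof (pos_INR N). lra. }
      replace (INR (S N)) with (x - 1) in IH by (unfold x; rewrite (S_INR (S N)); ring).
      (* For x >= 2 and r < 3/2, x - r >= x / 4, so 7 / (x - r)^2 <= 112 / (x (x - 1)), which
         telescopes; 112 is 7 times 16. *)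
      assert (T : Rabs (g x - / x) <= 112 * (/ (x - 1) - / x)).
      { eapply Rle_trans; [apply quadratic_term_bound; lra |].
        replace (112 * (/ (x - 1) - / x)) with (7 / ((x * (x - 1)) / 16)) by (field; lra).
        unfold Rdiv at 1 2. apply Rmult_le_compat_l; [lra |].
        apply Rinv_le_contravar; nra. }
      lra. }
  set (x := INR (S (S N))).
  assert (X : 2 <= x).
  { unfold x. rewrite !S_INR. pose proof (pos_INR N). lra. }
  destruct (harmonic_ln N) as [B1 B2]. fold x in B1.
  assert (B3 : ln (INR (S N)) <= ln x).
  { apply ln_le; [apply lt_0_INR; lia | apply le_INR; lia]. }
  assert (I : 0 < / INR (S N)) by (apply Rinv_0_lt_compat, lt_0_INR; lia).
  assert (Q := quadratic_pos r phi x H ltac:(lra)).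
  pose proof (COS_bound phi) as C.
  assert (R0 : 0 < r * x) by nra.
  assert (Q1 : x * x / 16 <= x * x + 2 * (r * x) * cos phi + r * r).
  { assert (0 <= r * x * (1 + cos phi)) by (apply Rmult_le_pos; lra).
    assert (x * x / 16 <= (x - r) * (x - r)) by nra. nra. }
  assert (Q2 : x * x + 2 * (r * x) * cos phi + r * r <= x * x * 16).
  { assert (0 <= r * x * (1 - cos phi)) by (apply Rmult_le_pos; lra).
    assert ((x + r) * (x + r) <= 16 * (x * x)) by nra. nra. }
  set (q := x * x + 2 * (r * x) * cos phi + r * r) in *.
  assert (X2 : 0 < x * x) by nra.
  apply ln_le in Q1; [| lra]. apply ln_le in Q2; [| exact Q].
  unfold Rdiv in Q1. rewrite ln_mult, ln_Rinv, ln_mult in Q1 by lra.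
  rewrite !ln_mult in Q2 by lra.
  assert (S : sum_f_R0 (fun n => g (INR (S n)) - / INR (S n)) N =
    sum_f_R0 (fun n => g (INR (S n))) N - sum_f_R0 (fun n => / INR (S n)) N) by apply minus_sum.
  rewrite S in A. apply Rabs_le_between in A.
  apply Rabs_le. unfold g in *. unfold Rdiv at 2. lra.
Qed.

Lemma atan_cot phi : 0 < phi < PI -> atan (cos phi / sin phi) = PI / 2 - phi.
Proof.
  intro H. rewrite <- (atan_tan (PI / 2 - phi)) by lra.
  unfold tan. rewrite sin_shift, cos_shift. reflexivity.
Qed.

Lemma is_lim_seq_atan (u : nat -> R) : is_lim_seq u p_infty -> is_lim_seq (fun n => atan (u n)) (PI / 2).
Proof.
  intro H. apply (is_lim_seq_ext_loc (fun n => PI / 2 - atan (/ u n))).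
  - destruct (proj1 (is_lim_seq_p_infty_Reals u) H 0) as [N HN].
    exists N. intros n Hn. rewrite atan_inv by (apply HN; lia). ring.
  - replace (Finite (PI / 2)) with (Finite (PI / 2 - atan 0)) by (rewrite atan_0; f_equal; ring).
    apply is_lim_seq_minus'; [apply is_lim_seq_const |].
    apply (is_lim_seq_continuous atan (fun n => / u n) 0).
    + apply derivable_continuous_pt. exists (/ (1 + 0 ^ 2)). apply derivable_pt_lim_atan.
    + apply (is_lim_seq_inv u p_infty H). discriminate.
Qed.

Lemma sum_dirichlet_wave_transform r phi N : Rabs phi < PI -> 0 < r ->
  is_int0 (fun v => sum_f_R0 (fun n => dirichlet_wave r (INR (S n)) v) N * kern phi v)
   (exp (ln r / 2) * (cos (phi / 2) * sum_f_R0 (fun n => (INR (S n) + r) /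
          (INR (S n) * INR (S n) + 2 * (r * INR (S n)) * cos phi + r * r)) N)).
Proof.
  intros H Hr.
  assert (T : forall n, is_int0 (fun v => dirichlet_wave r (INR (S n)) v * kern phi v)
    (exp (ln r / 2) * (cos (phi / 2) * ((INR (S n) + r) /
          (INR (S n) * INR (S n) + 2 * (r * INR (S n)) * cos phi + r * r))))).
  { intro n. apply dirichlet_wave_transform; [exact H | exact Hr | apply lt_0_INR; lia]. }
  induction N as [| N IH].
  - apply T.
  - rewrite tech5. evar_last.
    + eapply is_int0_ext; [| apply (is_int0_lincomb _ _ 1 1 _ _ IH (T (S N)))].
      intro v. cbv beta. rewrite tech5. ring.
    + cbv beta. ring.
Qed.

(** B is chosen before N, so at fixed phi the error vanishes with the tail. *)
Lemma damped_integral_approx r phi : Rabs phi < PI -> 0 < r -> exists B, forall N,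
  Rabs (damped_integral r phi - (exp (ln r / 2) * (cos (phi / 2) * sum_f_R0 (fun n => (INR (S n) + r) /
          (INR (S n) * INR (S n) + 2 * (r * INR (S n)) * cos phi + r * r)) N)
     - prim_transform r phi (INR (S (S N))))) <= Rabs (zeta_tail N) * B.
Proof.
  intros H Hr. destruct (kern_integral_bound phi H) as [B [B0 HB]]. exists B. intro N.
  assert (I : is_int0 (damped_integrand r phi) (damped_integral r phi)).
  { apply (RInt_gen_correct (V := R_CompleteNormedModule)). apply ex_damped_integral, H. }
  pose (f := fun v => zeta_wave r v - (sum_f_R0 (fun n => dirichlet_wave r (INR (S n)) v) N
                         - prim_wave r (INR (S (S N))) v)).
  destruct (HB f (Rabs (zeta_tail N))) as [l [L1 L2]].
  - intro v. apply (continuous_minus (V := R_NormedModule)); [apply continuous_zeta_wave |].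
    apply (continuous_minus (V := R_NormedModule)); [| apply continuous_prim_wave].
    induction N as [| N IH]; [apply continuous_dirichlet_wave |].
    apply (continuous_plus (V := R_NormedModule)
      (fun v => sum_f_R0 (fun n => dirichlet_wave r (INR (S n)) v) N)); [| apply continuous_dirichlet_wave].
    apply IH.
  - intros v Hv. eapply Rle_trans; [apply zeta_wave_approx |].
    pose proof (Cmod_crit v Hv). pose proof (Cmod_ge_0 (crit v)).
    pose proof (Rle_abs (zeta_tail N)). pose proof (Rabs_pos (zeta_tail N)). nra.
  - pose proof (is_int0_lincomb _ _ 1 (- (1)) _ _ I (is_int0_lincomb _ _ 1 (- (1)) _ _
      (sum_dirichlet_wave_transform r phi N H Hr)
      (prim_transform_correct r phi (INR (S (S N))) H))) as L3.
    cbv beta in L3. eapply is_int0_ext in L3.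
    + rewrite (is_int0_unique _ _ _ L1 L3) in L2.
      eapply Rle_trans; [| exact L2]. right. f_equal. ring.
    + intro v. cbv beta. rewrite damped_integrand_eq. unfold f. ring.
Qed.

(** K precedes phi. Letting N -> oo at fixed phi removes the error whose constant depends on phi and
    leaves only logarithmic terms, which carry the factor cos(phi/2). *)
Lemma damped_integral_estimate r : 1 / 2 < r < 3 / 2 -> r <> 1 -> exists K, forall phi, 0 < phi < PI ->
  Rabs (damped_integral r phi + exp (ln r / 2) * (phi * sin (phi / 2))) <= K * cos (phi / 2).
Proof.
  intros Hr Hn. destruct (log_sum_bound r Hr Hn) as [K [K0 HK]].
  set (rho := exp (ln r / 2)). assert (rho0 : 0 < rho) by apply exp_pos.
  exists (rho * (K + Rabs (ln (r * r) / 2))). intros phi H.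
  assert (C0 : 0 < cos (phi / 2)) by (apply cos_gt_0; lra).
  assert (S0 : 0 < sin phi) by (apply sin_gt_0; lra).
  assert (H' : Rabs phi < PI) by (rewrite Rabs_pos_eq; lra).
  destruct (damped_integral_approx r phi H' ltac:(lra)) as [B HB]. fold rho in HB.
  pose (u := fun N => (INR (S (S N)) + r * cos phi) / (r * sin phi)).
  assert (At : is_lim_seq (fun N => atan (u N)) (PI / 2)).
  { apply is_lim_seq_atan.
    apply (is_lim_seq_ext (fun N => (INR (S (S N)) + r * cos phi) * / (r * sin phi))); [reflexivity |].
    assert (P : 0 < / (r * sin phi)) by (apply Rinv_0_lt_compat; nra).
    evar_last.
    - apply is_lim_seq_scal_r. apply (is_lim_seq_plus _ _ p_infty (r * cos phi) p_infty).
      + apply (is_lim_seq_incr_1 (fun n => INR (S n))), (is_lim_seq_incr_1 INR), is_lim_seq_INR.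
      + apply is_lim_seq_const.
      + reflexivity.
    - apply is_Rbar_mult_unique. unfold is_Rbar_mult; simpl.
      destruct (Rle_dec 0 (/ (r * sin phi))) as [Hle | Hle]; [| exfalso; lra].
      destruct (Rle_lt_or_eq_dec 0 (/ (r * sin phi)) Hle) as [Hlt | Heq]; [reflexivity | exfalso; lra]. }
  (* The arctangent at x = 0 is PI / 2 - phi by [atan_cot], and at infinity it is PI / 2; the
     difference is the phi of the main term. *)
  pose (E := fun N => damped_integral r phi
    + rho * (sin (phi / 2) * (atan (u N) - (PI / 2 - phi)))).
  assert (Eb : forall N, Rabs (E N) <= rho * (K + Rabs (ln (r * r) / 2)) * cos (phi / 2)
                                      + Rabs (zeta_tail N) * B).
  { intro N. specialize (HB N). specialize (HK phi N H).
    rewrite prim_transform_eq in HB by (lra || apply lt_0_INR; lia).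
    unfold prim_closed in HB. fold rho in HB. fold (u N) in HB.
    replace ((0 + r * cos phi) / (r * sin phi)) with (cos phi / sin phi) in HB by (field; lra).
    rewrite (atan_cot phi H) in HB.
    replace (0 * 0 + 2 * (r * 0) * cos phi + r * r) with (r * r) in HB by ring.
    set (sm := sum_f_R0 _ N) in *. set (lq := ln (INR (S (S N)) * _ + _ + _)) in *.
    set (err := damped_integral r phi - _) in HB.
    replace (E N) with (err + rho * cos (phi / 2) * ((sm - lq / 2) + ln (r * r) / 2))
      by (unfold E, err; ring).
    eapply Rle_trans; [apply Rabs_triang |]. rewrite Rplus_comm.
    apply Rplus_le_compat; [| exact HB].
    rewrite Rabs_mult, (Rabs_pos_eq (rho * _)) by nra.
    replace (rho * (K + Rabs (ln (r * r) / 2)) * cos (phi / 2))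
      with (rho * cos (phi / 2) * (K + Rabs (ln (r * r) / 2))) by ring.
    apply Rmult_le_compat_l; [nra |].
    eapply Rle_trans; [apply Rabs_triang |]. lra. }
  apply (is_lim_seq_le (fun N => Rabs (E N))
    (fun N => rho * (K + Rabs (ln (r * r) / 2)) * cos (phi / 2) + Rabs (zeta_tail N) * B)
    (Rabs (damped_integral r phi + rho * (phi * sin (phi / 2))))
    (rho * (K + Rabs (ln (r * r) / 2)) * cos (phi / 2)) Eb).
  - apply (is_lim_seq_abs E (damped_integral r phi + rho * (phi * sin (phi / 2)))).
    replace (phi * sin (phi / 2)) with (sin (phi / 2) * (PI / 2 - (PI / 2 - phi))) by ring.
    apply is_lim_seq_plus'; [apply is_lim_seq_const |].
    apply (is_lim_seq_scal_l _ rho (sin (phi / 2) * (PI / 2 - (PI / 2 - phi)))).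
    apply (is_lim_seq_scal_l _ (sin (phi / 2)) (PI / 2 - (PI / 2 - phi))).
    apply is_lim_seq_minus'; [exact At | apply is_lim_seq_const].
  - replace (Finite (rho * (K + Rabs (ln (r * r) / 2)) * cos (phi / 2))) with
      (Finite (rho * (K + Rabs (ln (r * r) / 2)) * cos (phi / 2) + 0 * B)) by (f_equal; ring).
    apply is_lim_seq_plus'; [apply is_lim_seq_const |].
    apply (is_lim_seq_scal_r _ B 0).
    apply (is_lim_seq_abs_0 zeta_tail), is_lim_seq_zeta_tail.
Qed.

Theorem mainTheorem14 :
  (forall r phi : R, 0 < r -> Rabs phi < PI ->
     ex_RInt_gen (damped_integrand r phi) (at_point 0) (Rbar_locally p_infty)) /\
  exists L : R -> R,
    locally' 1 (fun r : R =>
      filterlim (damped_integral r) (at_left PI) (locally (L r))) /\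
    is_lim L 1 (- PI).
Proof.
  split; [intros r phi _; apply ex_damped_integral |].
  (* The inner limit is - pi sqrt r, from phi sin(phi/2) -> pi. *)
  exists (fun r => - (exp (ln r / 2) * PI)). split.
  - exists (mkposreal (1 / 2) ltac:(lra)). intros r Hr Hn.
    change (Rabs (r - 1) < 1 / 2) in Hr. apply Rabs_lt_between in Hr.
    destruct (damped_integral_estimate r ltac:(lra) Hn) as [K HK].
    assert (HP := PI_RGT_0).
    (* [b (-1)] and [b 1] enclose the damped integral and share their limit because cos(PI / 2) =
       0. *)
    pose (b := fun s phi => - (exp (ln r / 2) * (phi * sin (phi / 2))) + s * (K * cos (phi / 2))).
    assert (Lim : forall s, filterlim (b s) (at_left PI) (locally (- (exp (ln r / 2) * PI)))).
    { intro s. assert (C : continuous (b s) PI).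
      { apply (ex_derive_continuous (K := R_AbsRing) (V := R_NormedModule) (b s)).
        unfold b. auto_derive. auto. }
      replace (- (exp (ln r / 2) * PI)) with (b s PI)
        by (unfold b; rewrite sin_PI2, cos_PI2; ring).
      intros P HP'. exact (filter_le_within (F := locally PI) _ _ (C P HP')). }
    apply (filterlim_le_le (b (- 1)) _ (b 1) (- (exp (ln r / 2) * PI))); [| apply Lim | apply Lim].
    exists (mkposreal _ HP). intros phi Hphi Hlt.
    change (Rabs (phi - PI) < PI) in Hphi. apply Rabs_lt_between in Hphi.
    specialize (HK phi ltac:(lra)). apply Rabs_le_between in HK. unfold b. lra.
  - replace (- PI) with (- (exp (ln 1 / 2) * PI)).
    + apply (is_lim_continuity (fun r => - (exp (ln r / 2) * PI)) 1), continuity_pt_filterlim.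
      apply (ex_derive_continuous (K := R_AbsRing) (V := R_NormedModule)
        (fun r => - (exp (ln r / 2) * PI))).
      auto_derive. lra.
    + rewrite ln_1. replace (0 / 2) with 0 by field. rewrite exp_0. ring.
Qed.
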